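(* Let $n\ge 3$ be an integer, let $\omega>0$, and let $\alpha,\beta:[0,\omega]\to\mathbb{R}$ be continuous functions with $\beta(t)\le 0$ for all $t\in[0,\omega]$. Put $A=\int_0^\omega\alpha(t)\,dt$ and $B=\int_0^\omega\beta(t)\,dt$. Consider the differential equation $$\dot z = z^{n}+\alpha(t)z^{n-1}+\beta(t)z^{n-2},\qquad z\in\mathbb{C}.$$ Counting periodic solutions with multiplicity, the equation has: (i) two non-zero periodic solutions if $B<0$; at most one is positive and at most one is negative. If $B$ is small and negative, then there are two non-zero real periodic solutions. (ii) one non-zero periodic solution if $B=0$ and $A\ne 0$; this solution is a real solution. It is positive if $A<0$ and it is negative if $A>0$. (iii) no non-zero periodic solutions if $A=B=0$.
   Context: Here $t\in[0,\omega]$ is real and $z=z(t)$ is complex-valued. For $c\in\mathbb{C}$ let $z(t,c)$ denote the solution with $z(0,c)=c$. Let $Q\subset\mathbb{C}$ be the (open) set of all $c$ such that $z(t,c)$ is defined for all $t\in[0,\omega]$, and define the displacement function $q:Q\to\mathbb{C}$, $q(c)=z(\omega,c)-c$, which is holomorphic on $Q$. A periodic solution is a solution defined on $[0,\omega]$ with $z(0)=z(\omega)$, i.e. $z(t,c)$ with $c\in Q$ and $q(c)=0$ (the coefficients need not be periodic). The multiplicity of a periodic solution $\varphi$ is the multiplicity of $\varphi(0)$ as a zero of $q$. A periodic solution is non-zero if it is not the solution $z\equiv 0$; it is real (positive, negative) if it takes only real (positive real, negative real) values. *)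

(* Defs.v *)
From Stdlib Require Import Reals List ClassicalEpsilon.
From Coquelicot Require Import Coquelicot.
Local Open Scope R_scope.

Definition itv (omega t : R) : Prop := 0 <= t <= omega.

(* Functions on [0, omega] are total functions on R of which only the values on
   [0, omega] matter: continuity and derivatives are relative to the interval,
   hence one-sided at the endpoints. *)
Definition cont_itv (omega : R) (f : R -> R) : Prop := continuous_on (itv omega) f.

Definition is_derive_itv (omega : R) (z : R -> C) (t : R) (l : C) : Prop :=
  filterdiff (U := R_NormedModule) (V := C_R_NormedModule)
    z (within (itv omega) (locally t)) (fun h => scal h l).

Definition is_solution (n : nat) (omega : R) (alpha beta : R -> R) (z : R -> C) : Prop :=
  forall t, itv omega t ->
    is_derive_itv omega z t
      (Cplus (Cplus (Cpow (z t) n)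
                    (Cmult (RtoC (alpha t)) (Cpow (z t) (n - 1))))
             (Cmult (RtoC (beta t)) (Cpow (z t) (n - 2)))).

Definition solution_from (n : nat) (omega : R) (alpha beta : R -> R) (c : C)
    (z : R -> C) : Prop :=
  is_solution n omega alpha beta z /\ z 0 = c.

(* The set Q of initial values whose solution is defined on all of [0, omega]. *)
Definition dom_q (n : nat) (omega : R) (alpha beta : R -> R) (c : C) : Prop :=
  exists z : R -> C, solution_from n omega alpha beta c z.

(* z(t, c); meaningful for c in dom_q and t in [0, omega] only (the solution is
   unique on [0, omega]), arbitrary otherwise. *)
Definition flow (n : nat) (omega : R) (alpha beta : R -> R) (t : R) (c : C) : C :=
  epsilon (inhabits (fun _ : R => RtoC 0)) (solution_from n omega alpha beta c) t.

Definition displacement (n : nat) (omega : R) (alpha beta : R -> R) (c : C) : C :=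
  Cminus (flow n omega alpha beta omega c) c.

Definition holomorphic_near (g : C -> C) (c : C) : Prop :=
  locally (T := C_UniformSpace) c
    (fun w => ex_derive (K := C_AbsRing) (V := C_NormedModule) g w).

Definition zero_multiplicity (f : C -> C) (c : C) (m : nat) : Prop :=
  exists g : C -> C,
    holomorphic_near g c /\ g c <> RtoC 0 /\
    locally (T := C_UniformSpace) c
      (fun w => f w = Cmult (Cpow (Cminus w c) m) (g w)).

Definition periodic_solution (n : nat) (omega : R) (alpha beta : R -> R)
    (z : R -> C) : Prop :=
  is_solution n omega alpha beta z /\ z 0 = z omega.

Definition nonzero_sol (omega : R) (z : R -> C) : Prop :=
  ~ (forall t, itv omega t -> z t = RtoC 0).

Definition real_sol (omega : R) (z : R -> C) : Prop :=
  forall t, itv omega t -> Im (z t) = 0.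

Definition positive_sol (omega : R) (z : R -> C) : Prop :=
  forall t, itv omega t -> Im (z t) = 0 /\ 0 < Re (z t).

Definition negative_sol (omega : R) (z : R -> C) : Prop :=
  forall t, itv omega t -> Im (z t) = 0 /\ Re (z t) < 0.

(* There are finitely many periodic solutions with property P, and their
   multiplicities add up to k.  The list l pairs the initial value of each of
   them (listed once) with its multiplicity as a zero of q. *)
Definition count_periodic (n : nat) (omega : R) (alpha beta : R -> R)
    (P : (R -> C) -> Prop) (k : nat) : Prop :=
  exists l : list (C * nat),
    NoDup (map fst l) /\
    (forall c : C, In c (map fst l) <->
       exists z, periodic_solution n omega alpha beta z /\ P z /\ z 0 = c) /\
    (forall c m, In (c, m) l ->
       dom_q n omega alpha beta c /\
       zero_multiplicity (displacement n omega alpha beta) c m) /\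
    list_sum (map snd l) = k.

(* Main.v *)
Require Import Defs.
From Stdlib Require Import Reals Lra Lia List ClassicalEpsilon ssreflect.
From Coquelicot Require Import Coquelicot.
Local Open Scope R_scope.

(* Let m = n - 2.  Along a non-vanishing solution (z^(-m))' = - m (z + alpha + beta / z),
   so two solutions satisfy
     (z1^(-m) - z2^(-m))' = - m (z1 - z2) (1 - beta / (z1 z2)).
   As beta <= 0, the last factor is at least 1 whenever z1 z2 > 0.  Applied to a solution
   and its conjugate this excludes non-real periodic solutions; applied to two real
   solutions of the same sign it leaves at most one positive and one negative periodic
   solution.  When beta = 0, the derivative of z^(-m) + m int alpha is - m z, which links the
   sign of a periodic solution to the sign of A.
   A positive periodic solution is a zero of q between a small c, where integrating
   (z^(-m))' shows q(c) < 0, and a level r at which the field is positive; cutting the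
   field off outside [-r, r] makes the flow global, and a solution which returns to its
   initial value c < r never feels the cut-off.  Negative solutions are reduced to positive
   ones by z -> -z, combined with time reversal for even n.  Hence B < 0 always gives one
   positive and one negative periodic solution, without any smallness assumption.
   Each of these zeros of q is simple, because the solution D of the variational equation
   with D(0) = 1 satisfies (D z^(-n+1))' = z^(n-3) (z^2 - beta) D z^(-n+1). *)

(** * Existence for globally Lipschitz fields *)

(** A multiplicity is witnessed by a factor g with q = (w - c) g that is complex differentiable on a
    whole neighbourhood of c. Hence all initial values near c must have solutions up to time omega,
    and the flow needs an expansion whose remainder is uniform in w. Both come from Gronwall
    estimates. Around any solution the flow is expanded with a remainder of order |h|^3, where h is
    the change of initial value: off c a quadratic remainder would do, but at c the division by w -
    c costs one order.

    The polynomial field is not globally Lipschitz, so Picard iteration is run on a clipped field,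
    which has a global flow; a solution of the clipped equation that provably stays in the unclipped
    region solves the original one.

    Derivatives in the statement are one-sided at 0 and omega. Solutions are therefore continued
    along their tangents, and coefficients as constants, so that all calculus uses two-sided
    derivatives of real functions. *)

Lemma exp_le_compat (x y : R) : x <= y -> exp x <= exp y.
Proof. intros [h | ->]; [left; now apply exp_increasing | apply Rle_refl]. Qed.

(** In a normed module the uniform balls match norm balls only up to [norm_factor]; estimates are
    therefore written with this genuine distance. *)
Definition ndist {V : NormedModule R_AbsRing} (x y : V) : R := norm (minus x y).

Lemma ndist_triangle {V : NormedModule R_AbsRing} (x y z : V) :
  ndist x z <= ndist x y + ndist y z.
Proof. unfold ndist. rewrite (minus_trans y). apply norm_triangle. Qed.

Lemma ndist_sym {V : NormedModule R_AbsRing} (x y : V) : ndist x y = ndist y x.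
Proof. unfold ndist. now rewrite -norm_opp opp_minus. Qed.

Lemma ndist_refl {V : NormedModule R_AbsRing} (x : V) : ndist x x = 0.
Proof. unfold ndist. rewrite minus_eq_zero. apply norm_zero. Qed.

Lemma ndist_plus_l {V : NormedModule R_AbsRing} (x y z : V) :
  ndist (plus x y) (plus x z) = ndist y z.
Proof.
  unfold ndist. f_equal. unfold minus.
  rewrite opp_plus plus_assoc (plus_comm x y) -(plus_assoc y x).
  now rewrite plus_opp_r plus_zero_r.
Qed.

Lemma ndist_ball {V : NormedModule R_AbsRing} (x y : V) (eps : R) :
  ndist y x < eps -> ball x eps y.
Proof. apply norm_compat1. Qed.

Lemma ball_ndist {V : NormedModule R_AbsRing} (x y : V) (eps : R)
  (h : 0 < eps / @norm_factor _ V) :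
  ball x (eps / @norm_factor _ V) y -> ndist y x < eps.
Proof.
  intros hb. apply (norm_compat2 x y (mkposreal _ h)) in hb. simpl in hb.
  replace (norm_factor * (eps / norm_factor)) with eps in hb; [exact hb |].
  field. apply Rgt_not_eq, norm_factor_gt_0.
Qed.

Lemma continuous_ndist_iff {V : NormedModule R_AbsRing} (f : R -> V) (t : R) :
  continuous f t <->
  forall eps : R, 0 < eps -> locally t (fun s => ndist (f s) (f t) < eps).
Proof.
  split.
  - intros H eps he.
    assert (hf : 0 < eps / @norm_factor _ V).
    { apply Rdiv_lt_0_compat; [exact he | apply norm_factor_gt_0]. }
    apply filterlim_locally with (eps := mkposreal _ hf) in H.
    apply: filter_imp H => s hs. now apply ball_ndist.
  - intros H. apply filterlim_locally. intros eps.
    apply: filter_imp (H eps (cond_pos eps)) => s hs. now apply ndist_ball.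
Qed.

Lemma continuous_ndist {V : NormedModule R_AbsRing} (f g : R -> V) (t : R) :
  continuous f t -> continuous g t -> continuous (fun s => ndist (f s) (g s)) t.
Proof.
  intros hf hg. apply (continuous_comp (fun s => minus (f s) (g s)) norm).
  - now apply @continuous_minus.
  - apply filterlim_norm.
Qed.

(** * Retraction of the line onto the interval *)

Section Clamp.
Variable omega : R.
Hypothesis homega : 0 < omega.

(** Composition with this 1-Lipschitz retraction spreads data given on the interval to the whole
    line, where continuity is no longer relative. *)
Definition clamp (t : R) : R := Rmax 0 (Rmin t omega).

Lemma clamp_itv (t : R) : itv omega (clamp t).
Proof. unfold clamp, itv, Rmax, Rmin; repeat destruct Rle_dec; lra. Qed.

Lemma clamp_id (t : R) : itv omega t -> clamp t = t.
Proof. unfold clamp, itv, Rmax, Rmin; repeat destruct Rle_dec; lra. Qed.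

Lemma clamp_lip (s t : R) : Rabs (clamp s - clamp t) <= Rabs (s - t).
Proof.
  unfold clamp, Rmax, Rmin, Rabs; repeat destruct Rle_dec; repeat destruct Rcase_abs; lra.
Qed.

Lemma clamp_continuous (t : R) : continuous clamp t.
Proof.
  apply filterlim_locally. intros eps. exists eps. intros s hs.
  apply Rle_lt_trans with (2 := hs). apply clamp_lip.
Qed.
End Clamp.

(** * Picard iteration *)

Section Picard.
Variable V : CompleteNormedModule R_AbsRing.
Variables (omega L : R) (F : R -> V -> V) (c : V).
Hypothesis homega : 0 < omega.
Hypothesis hL : 0 < L.
Hypothesis F_lip : forall t x y, ndist (F t x) (F t y) <= L * ndist x y.
Hypothesis F_cont : forall x t, continuous (fun s => F s x) t.

Lemma lipschitz_field_comp (z : R -> V) (t : R) :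
  continuous z t -> continuous (fun s => F s (z s)) t.
Proof.
  intros hz. apply (proj2 (continuous_ndist_iff (fun s => F s (z s)) t)). intros eps he.
  assert (h1 : 0 < eps / (2 * L)) by (apply Rdiv_lt_0_compat; lra).
  assert (h2 : 0 < eps / 2) by lra.
  pose proof (proj1 (continuous_ndist_iff _ _) hz _ h1) as H1.
  pose proof (proj1 (continuous_ndist_iff _ _) (F_cont (z t) t) _ h2) as H2.
  apply: filter_imp (filter_and _ _ H1 H2) => s [k1 k2].
  eapply Rle_lt_trans; [apply (ndist_triangle _ (F s (z t)) _) |].
  pose proof (F_lip s (z s) (z t)) as k3.
  apply (Rmult_lt_compat_l L) in k1; [| exact hL].
  replace (L * (eps / (2 * L))) with (eps / 2) in k1 by (field; lra).
  lra.
Qed.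

(** The clamped upper limit makes the iterates constant outside the interval. Bounds are then
    uniform on all of R, and the limit can be taken in the complete space of functions on R with
    uniform convergence. *)
Fixpoint picard (k : nat) (t : R) : V :=
  match k with
  | O => c
  | S k => plus c (RInt (fun s => F s (picard k s)) 0 (clamp omega t))
  end.

Lemma is_derive_primitive (G : R -> V) (t : R) :
  (forall s, continuous G s) -> is_derive (fun s => RInt G 0 s) t (G t).
Proof.
  intros hG. apply is_derive_RInt with 0; [| apply hG].
  apply filter_forall. intros s. apply RInt_correct, ex_RInt_continuous. auto.
Qed.

Lemma primitive_continuous (G : R -> V) (t : R) :
  (forall s, continuous G s) -> continuous (fun s => RInt G 0 s) t.
Proof.
  intros hG. apply (@ex_derive_continuous R_AbsRing V (fun s => RInt G 0 s) t).
  exists (G t). now apply is_derive_primitive.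
Qed.

Lemma picard_continuous (k : nat) (t : R) : continuous (picard k) t.
Proof.
  revert t; induction k as [|k IH]; intros t; simpl.
  - apply continuous_const.
  - assert (hG : continuous (fun b => RInt (fun s => F s (picard k s)) 0 b) (clamp omega t)).
    { apply primitive_continuous. intros s. now apply lipschitz_field_comp. }
    apply (@continuous_plus R_UniformSpace R_AbsRing V (fun _ => c)); [apply continuous_const |].
    refine (@continuous_comp R_UniformSpace R_UniformSpace V (clamp omega) _ t _ hG).
    now apply clamp_continuous.
Qed.

Lemma picard_integrable (k : nat) (t : R) :
  is_RInt (fun s => F s (picard k s)) 0 t (RInt (fun s => F s (picard k s)) 0 t).
Proof.
  apply RInt_correct, ex_RInt_continuous. intros s _.
  apply lipschitz_field_comp, picard_continuous.
Qed.

(* The weight exp (2 L t) turns the iteration into a contraction of ratio 1/2. *)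
Lemma picard_step (M : R) :
  0 <= M -> (forall t, ndist (picard 1 t) (picard 0 t) <= M) ->
  forall k t, ndist (picard (S k) t) (picard k t)
              <= M * (/ 2) ^ k * exp (2 * L * clamp omega t).
Proof.
  intros hM h0 k; induction k as [|k IH]; intros t.
  - eapply Rle_trans; [apply h0 |]. simpl. rewrite Rmult_1_r.
    pose proof (clamp_itv omega homega t) as [hc _].
    pose proof (exp_ineq1_le (2 * L * clamp omega t)).
    assert (0 <= L * clamp omega t) by (apply Rmult_le_pos; lra). nra.
  - change (picard (S (S k)) t)
      with (plus c (RInt (fun s => F s (picard (S k) s)) 0 (clamp omega t))).
    change (picard (S k) t)
      with (plus c (RInt (fun s => F s (picard k s)) 0 (clamp omega t))).
    rewrite ndist_plus_l.
    set (T := clamp omega t).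
    assert (hT : itv omega T) by now apply clamp_itv.
    assert (hM2 : 0 <= M * (/ 2) ^ k) by (apply Rmult_le_pos; [| apply pow_le]; lra).
    apply Rle_trans with
      (M * (/ 2) ^ k / 2 * exp (2 * L * T) - M * (/ 2) ^ k / 2 * exp (2 * L * 0)).
    2: { rewrite Rmult_0_r exp_0. simpl. lra. }
    apply (@norm_RInt_le V
      (fun s => minus (F s (picard (S k) s)) (F s (picard k s)))
      (fun s => M * (/ 2) ^ k / 2 * (2 * L * exp (2 * L * s))) 0 T).
    + apply hT.
    + intros s hs. eapply Rle_trans; [apply F_lip |].
      apply Rle_trans with (L * (M * (/ 2) ^ k * exp (2 * L * s))).
      2: right; field.
      apply Rmult_le_compat_l; [lra |].
      replace s with (clamp omega s) at 3.
      2: { apply clamp_id; unfold itv in *; lra. }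
      apply IH.
    + exact (@is_RInt_minus V _ _ 0 T _ _ (picard_integrable (S k) T) (picard_integrable k T)).
    + apply (is_RInt_derive (fun s => M * (/ 2) ^ k / 2 * exp (2 * L * s))).
      * intros s _. auto_derive; trivial. ring.
      * intros s _. apply (ex_derive_continuous (V := R_NormedModule)). now auto_derive.
Qed.

Lemma picard_bound : exists M, 0 <= M /\
  forall t, ndist (picard 1 t) (picard 0 t) <= M.
Proof.
  destruct (continuity_ab_maj (fun t => ndist (picard 1 t) (picard 0 t)) 0 omega)
    as [m [hm _]]; [lra | |].
  - intros t _. apply continuity_pt_filterlim.
    exact (continuous_ndist (V := V) _ _ t (picard_continuous 1 t) (picard_continuous 0 t)).
  - exists (ndist (picard 1 m) (picard 0 m)). split; [apply norm_ge_0 |].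
    intros t.
    replace (ndist (picard 1 t) (picard 0 t))
      with (ndist (picard 1 (clamp omega t)) (picard 0 (clamp omega t))).
    + apply hm. now apply clamp_itv.
    + simpl. rewrite (clamp_id omega (clamp omega t)); [reflexivity |].
      now apply clamp_itv.
Qed.

Lemma picard_cauchy (M : R) :
  0 <= M -> (forall t, ndist (picard 1 t) (picard 0 t) <= M) ->
  forall k j t, ndist (picard (k + j) t) (picard k t)
                <= 2 * (M * (/ 2) ^ k * exp (2 * L * omega)).
Proof.
  intros hM h0.
  (* The factor 1 - 2^(-j) is the partial geometric sum; with it the induction on [j] closes, and it
     is bounded by 1 afterwards. *)
  assert (H : forall k j t, ndist (picard (k + j) t) (picard k t)
                <= 2 * (M * (/ 2) ^ k * exp (2 * L * omega)) * (1 - (/ 2) ^ j)).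
  { intros k j; revert k; induction j as [|j IH]; intros k t.
    - rewrite Nat.add_0_r ndist_refl. simpl. lra.
    - rewrite <- Nat.add_succ_comm.
      eapply Rle_trans; [apply (ndist_triangle _ (picard (S k) t) _) |].
      specialize (IH (S k) t).
      pose proof (picard_step M hM h0 k t) as h1.
      assert (h2 : exp (2 * L * clamp omega t) <= exp (2 * L * omega)).
      { apply exp_le_compat. destruct (clamp_itv omega homega t). nra. }
      assert (hM2 : 0 <= M * (/ 2) ^ k) by (apply Rmult_le_pos; [| apply pow_le]; lra).
      pose proof (Rmult_le_compat_l _ _ _ hM2 h2).
      rewrite <- !tech_pow_Rmult in *.
      set (a := ndist _ (picard (S k) t)) in *. set (b := ndist (picard (S k) t) _) in *.
      set (E := exp (2 * L * omega)) in *. set (m := M * (/ 2) ^ k) in *.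
      replace (M * (/ 2 * (/ 2) ^ k)) with (m / 2) in IH by (unfold m; field).
      nra. }
  intros k j t. eapply Rle_trans; [apply H |].
  assert (0 <= (/ 2) ^ j) by (apply pow_le; lra).
  assert (hM2 : 0 <= M * (/ 2) ^ k) by (apply Rmult_le_pos; [| apply pow_le]; lra).
  pose proof (exp_pos (2 * L * omega)).
  assert (0 <= M * (/ 2) ^ k * exp (2 * L * omega)) by nra. nra.
Qed.

Lemma picard_limit : exists g : R -> V,
  filterlim (picard : nat -> fct_UniformSpace R V) eventually (locally (g : fct_UniformSpace R V)).
Proof.
  destruct picard_bound as [M [hM h0]].
  apply (filterlim_locally_cauchy (U := @fct_CompleteSpace R V)).
  intros eps.
  set (K := 4 * M * exp (2 * L * omega)).
  assert (hK : 0 <= K) by (unfold K; pose proof (exp_pos (2 * L * omega)); nra).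
  destruct (pow_lt_1_zero (/ 2)) with (y := eps / (K + 1)) as [N hN].
  { rewrite Rabs_pos_eq; lra. }
  { apply Rdiv_lt_0_compat; [apply eps | lra]. }
  exists (fun k => (N <= k)%nat). split; [now exists N |].
  assert (B : forall k t, (N <= k)%nat ->
            ndist (picard k t) (picard N t) < eps / 2).
  { intros k t hk. replace k with (N + (k - N))%nat by lia.
    eapply Rle_lt_trans; [apply (picard_cauchy M hM h0) |].
    specialize (hN N (le_n _)). rewrite Rabs_pos_eq in hN; [| apply pow_le; lra].
    apply Rlt_div_r in hN; [| lra].
    assert (0 <= (/ 2) ^ N) by (apply pow_le; lra).
    pose proof (pow_lt (/2) N ltac:(lra)).
    unfold K in hN. nra. }
  intros u v hu hv t. apply (@ndist_ball V).
  eapply Rle_lt_trans; [apply (ndist_triangle _ (picard N t) _) |].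
  pose proof (B _ t hu) as b1. pose proof (B _ t hv) as b2.
  rewrite ndist_sym in b1. lra.
Qed.

Theorem picard_lindelof : exists z : R -> V,
  z 0 = c /\ forall t, itv omega t -> is_derive z t (F t (z t)).
Proof.
  destruct picard_limit as [g hg].
  assert (hpt : forall t, filterlim (fun k => picard k t) eventually (locally (g t))).
  { intros t. apply filterlim_locally. intros eps.
    apply filterlim_locally with (eps := eps) in hg.
    apply: filter_imp hg => k hk. apply hk. }
  assert (hgc : forall t, continuous g t).
  { intros t. apply filterlim_locally. intros eps.
    assert (h3 : 0 < eps / 3) by (pose proof (cond_pos eps); lra).
    set (e := mkposreal _ h3).
    apply filterlim_locally with (eps := e) in hg.
    destruct hg as [N hN]. specialize (hN N (le_n _)).
    pose proof (picard_continuous N t) as hc.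
    apply filterlim_locally with (eps := e) in hc.
    apply: filter_imp hc => s hs.
    replace (pos eps) with (e + e + e) by (simpl; lra).
    apply ball_triangle with (picard N s); [apply ball_triangle with (picard N t) |].
    - apply hN.
    - exact hs.
    - apply ball_sym, hN. }
  assert (hFg : forall t, continuous (fun s => F s (g s)) t).
  { intros t. now apply lipschitz_field_comp. }
  assert (hfix : forall t, itv omega t -> g t = plus c (RInt (fun s => F s (g s)) 0 t)).
  { intros t ht.
    destruct (filterlim_RInt (fun k s => F s (picard k s)) 0 t eventually _
       (fun s => F s (g s)) (fun k => RInt (fun s => F s (picard k s)) 0 t))
      as [l [hl1 hl2]].
    - intros k. apply picard_integrable.
    - apply filterlim_locally. intros eps.
      assert (he : 0 < eps / L / (@norm_factor _ V)).
      { repeat apply Rdiv_lt_0_compat; try apply eps; [exact hL | apply norm_factor_gt_0]. }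
      apply filterlim_locally with (eps := mkposreal _ he) in hg.
      apply: filter_imp hg => k hk s. specialize (hk s).
      apply (@ndist_ball V). apply (@ball_ndist V _ _ _ he) in hk.
      eapply Rle_lt_trans; [apply F_lip |].
      apply (Rmult_lt_compat_l L) in hk; [| exact hL].
      replace (L * (eps / L)) with (pos eps) in hk; [exact hk | field; lra].
    (* The shifted sequence [picard (S k) t] converges to [g t], and also to [c] plus the integral
       because the integrands converge uniformly. *)
    - rewrite (is_RInt_unique _ _ _ _ hl2).
      apply (filterlim_locally_unique (fun k => picard (S k) t) (F := eventually)).
      + apply (filterlim_comp _ _ _ S (fun k => picard k t) eventually eventually).
        * apply eventually_subseq. intros; lia.
        * apply hpt.
      + simpl. rewrite (clamp_id omega t ht).
        apply (filterlim_comp_2 (G := locally c) (H := locally l) (fun _ => c)).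
        * apply filterlim_const.
        * exact hl1.
        * apply (@filterlim_plus R_AbsRing V). }
  (* The limit [g] is constant outside the interval, so it may have a corner at an endpoint. The
     right-hand side of the fixed-point equation agrees with it on the interval and has two-sided
     derivatives. *)
  exists (fun t => plus c (RInt (fun s => F s (g s)) 0 t)). split.
  - rewrite RInt_point. apply plus_zero_r.
  - intros t ht. rewrite <- (hfix t ht).
    replace (F t (g t)) with (plus zero (F t (g t))) by apply plus_zero_l.
    apply (@is_derive_plus R_AbsRing V (fun _ => c)); [apply @is_derive_const |].
    now apply (is_derive_primitive (fun s => F s (g s))).
Qed.
End Picard.

(** * Componentwise derivatives and Gronwall estimates *)

(** Working componentwise reduces product, quotient and mean value arguments for complex-valued
    curves to real ones. *)
Definition cderiv (z : R -> C) (t : R) (l : C) : Prop :=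
  is_derive (fun s => Re (z s)) t (Re l) /\ is_derive (fun s => Im (z s)) t (Im l).

Lemma C_eq (x y : C) : Re x = Re y -> Im x = Im y -> x = y.
Proof. destruct x, y; simpl; congruence. Qed.

Lemma Cmod_sqr (z : C) : Cmod z ^ 2 = Re z ^ 2 + Im z ^ 2.
Proof. apply Cmod2_alt. Qed.

Lemma im_le_Cmod (z : C) : Rabs (Im z) <= Cmod z.
Proof. eapply Rle_trans; [apply Rmax_r | apply Rmax_Cmod]. Qed.

Lemma Cmod_le_Re_Im (z : C) : Cmod z <= Rabs (Re z) + Rabs (Im z).
Proof.
  apply Rsqr_incr_0_var; [| pose proof (Rabs_pos (Re z)); pose proof (Rabs_pos (Im z)); lra].
  rewrite !Rsqr_pow2 Cmod_sqr.
  pose proof (Rabs_pos (Re z)); pose proof (Rabs_pos (Im z)).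
  rewrite <- (pow2_abs (Re z)), <- (pow2_abs (Im z)). nra.
Qed.

Lemma cderiv_eq (z : R -> C) (t : R) (l l' : C) : cderiv z t l -> l = l' -> cderiv z t l'.
Proof. now intros H <-. Qed.

Lemma cderiv_ext (z w : R -> C) (t : R) (l : C) :
  (forall s, z s = w s) -> cderiv z t l -> cderiv w t l.
Proof.
  intros H [H1 H2]; split.
  - apply (is_derive_ext (fun s => Re (z s))); [intros s; now rewrite H | exact H1].
  - apply (is_derive_ext (fun s => Im (z s))); [intros s; now rewrite H | exact H2].
Qed.

Lemma cderiv_const (c : C) (t : R) : cderiv (fun _ => c) t (RtoC 0).
Proof. split; exact (@is_derive_const R_AbsRing R_NormedModule _ t). Qed.

Lemma cderiv_real (f : R -> R) (t l : R) :
  is_derive f t l -> cderiv (fun s => RtoC (f s)) t (RtoC l).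
Proof. intros H; split; [exact H | exact (@is_derive_const R_AbsRing R_NormedModule 0 t)]. Qed.

Lemma cderiv_plus (z w : R -> C) (t : R) (l m : C) :
  cderiv z t l -> cderiv w t m -> cderiv (fun s => Cplus (z s) (w s)) t (Cplus l m).
Proof. intros [H1 H2] [H3 H4]; split.
  - exact (@is_derive_plus R_AbsRing R_NormedModule _ _ t _ _ H1 H3).
  - exact (@is_derive_plus R_AbsRing R_NormedModule _ _ t _ _ H2 H4).
 Qed.

Lemma cderiv_opp (z : R -> C) (t : R) (l : C) :
  cderiv z t l -> cderiv (fun s => Copp (z s)) t (Copp l).
Proof.
  intros [H1 H2]; split.
  - exact (@is_derive_opp R_AbsRing R_NormedModule _ t _ H1).
  - exact (@is_derive_opp R_AbsRing R_NormedModule _ t _ H2).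
Qed.

Lemma cderiv_minus (z w : R -> C) (t : R) (l m : C) :
  cderiv z t l -> cderiv w t m -> cderiv (fun s => Cminus (z s) (w s)) t (Cminus l m).
Proof. intros H1 H2. apply cderiv_plus, cderiv_opp; assumption. Qed.

Lemma cderiv_conj (z : R -> C) (t : R) (l : C) :
  cderiv z t l -> cderiv (fun s => Cconj (z s)) t (Cconj l).
Proof. intros [H1 H2]; split; [exact H1 |].
  exact (@is_derive_opp R_AbsRing R_NormedModule _ t _ H2). Qed.

Lemma is_derive_Rmult (f g : R -> R) (t df dg : R) :
  is_derive f t df -> is_derive g t dg ->
  is_derive (fun s => f s * g s) t (df * g t + f t * dg).
Proof. intros H1 H2. apply (@is_derive_mult R_AbsRing f g t df dg H1 H2 Rmult_comm). Qed.

Lemma cderiv_mult (z w : R -> C) (t : R) (l m : C) :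
  cderiv z t l -> cderiv w t m ->
  cderiv (fun s => Cmult (z s) (w s)) t (Cplus (Cmult l (w t)) (Cmult (z t) m)).
Proof.
  intros [H1 H2] [H3 H4]; split.
  - apply (is_derive_ext (fun s => Re (z s) * Re (w s) - Im (z s) * Im (w s)));
      [reflexivity |].
    replace (Re (l * w t + z t * m)%C)
      with ((Re l * Re (w t) + Re (z t) * Re m) - (Im l * Im (w t) + Im (z t) * Im m))
      by (unfold Re, Im; simpl; ring).
    apply @is_derive_minus; now apply is_derive_Rmult.
  - apply (is_derive_ext (fun s => Re (z s) * Im (w s) + Im (z s) * Re (w s)));
      [reflexivity |].
    replace (Im (l * w t + z t * m)%C)
      with ((Re l * Im (w t) + Re (z t) * Im m) + (Im l * Re (w t) + Im (z t) * Re m))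
      by (unfold Re, Im; simpl; ring).
    apply @is_derive_plus; now apply is_derive_Rmult.
Qed.

Lemma norm2_pos (z : C) : z <> RtoC 0 -> 0 < Re z ^ 2 + Im z ^ 2.
Proof.
  intros h. rewrite <- Cmod_sqr. apply pow_lt. now apply Cmod_gt_0.
Qed.

Lemma cderiv_inv (z : R -> C) (t : R) (l : C) :
  z t <> RtoC 0 -> cderiv z t l ->
  cderiv (fun s => Cinv (z s)) t (Copp (Cdiv l (Cmult (z t) (z t)))).
Proof.
  intros hz [H1 H2].
  pose proof (norm2_pos _ hz) as hN.
  assert (hN' : is_derive (fun s => Re (z s) ^ 2 + Im (z s) ^ 2) t
                  (2 * Re (z t) * Re l + 2 * Im (z t) * Im l)).
  { apply (is_derive_ext (fun s => Re (z s) * Re (z s) + Im (z s) * Im (z s)));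
      [intros s; simpl; ring |].
    replace (2 * Re (z t) * Re l + 2 * Im (z t) * Im l) with
      ((Re l * Re (z t) + Re (z t) * Re l) + (Im l * Im (z t) + Im (z t) * Im l)) by ring.
    apply @is_derive_plus; now apply is_derive_Rmult. }
  assert (hz2 : Cmult (z t) (z t) <> RtoC 0) by now apply Cmult_neq_0.
  pose proof (norm2_pos _ hz2) as hN2. simpl in hN2, hN.
  split; cbn [Re Im Cinv fst snd].
  - apply (is_derive_ext (fun s => Re (z s) / (Re (z s) ^ 2 + Im (z s) ^ 2)));
      [reflexivity |].
    evar_last.
    { apply is_derive_div; [exact H1 | exact hN' | lra]. }
    simpl. unfold Re, Im in *. destruct (z t) as [x y], l as [p q]; simpl in *.
    field. split; nra.
  - apply (is_derive_ext (fun s => - Im (z s) / (Re (z s) ^ 2 + Im (z s) ^ 2)));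
      [reflexivity |].
    evar_last.
    { apply is_derive_div; [exact (@is_derive_opp R_AbsRing R_NormedModule _ t _ H2) | exact hN' | lra]. }
    simpl. unfold Re, Im, opp in *. destruct (z t) as [x y], l as [p q]; simpl in *.
    field. split; nra.
Qed.

Lemma cderiv_pow (z : R -> C) (t : R) (l : C) (n : nat) :
  cderiv z t l ->
  cderiv (fun s => Cpow (z s) (S n)) t (Cmult (RtoC (INR (S n))) (Cmult (Cpow (z t) n) l)).
Proof.
  intros H. induction n as [|n IH].
  - eapply cderiv_ext; [intros s; symmetry; apply Cpow_1_r |].
    eapply cderiv_eq; [exact H |]. simpl. ring.
  - apply (cderiv_ext (fun s => Cmult (z s) (Cpow (z s) (S n)))); [intros; reflexivity |].
    eapply cderiv_eq; [apply (cderiv_mult _ _ _ _ _ H IH) |].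
    rewrite (S_INR (S n)) RtoC_plus !Cpow_S. ring.
Qed.

Lemma derive_monotone (f df : R -> R) (a b : R) :
  a <= b -> (forall t, a <= t <= b -> is_derive f t (df t)) ->
  (forall t, a <= t <= b -> 0 <= df t) -> f a <= f b.
Proof.
  intros hab hd h0.
  destruct (MVT_gen f a b df) as [c [hc e]].
  - rewrite Rmin_left ?Rmax_right; try lra. intros x hx; apply hd; lra.
  - rewrite Rmin_left ?Rmax_right; try lra. intros x hx.
    apply continuity_pt_filterlim, @ex_derive_continuous. exists (df x). apply hd; lra.
  - rewrite Rmin_left in hc; [| lra]. rewrite Rmax_right in hc; [| lra].
    pose proof (h0 c hc). nra.
Qed.

Lemma derive_monotone_strict (f df : R -> R) (a b : R) :
  a < b -> (forall t, a <= t <= b -> is_derive f t (df t)) ->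
  (forall t, a <= t <= b -> 0 < df t) -> f a < f b.
Proof.
  intros hab hd h0.
  destruct (MVT_gen f a b df) as [c [hc e]].
  - rewrite Rmin_left ?Rmax_right; try lra. intros x hx; apply hd; lra.
  - rewrite Rmin_left ?Rmax_right; try lra. intros x hx.
    apply continuity_pt_filterlim, @ex_derive_continuous. exists (df x). apply hd; lra.
  - rewrite Rmin_left in hc; [| lra]. rewrite Rmax_right in hc; [| lra].
    pose proof (h0 c hc). nra.
Qed.

Lemma cderiv_norm2 (u : R -> C) (t : R) (l : C) :
  cderiv u t l ->
  is_derive (fun s => Cmod (u s) ^ 2) t (2 * (Re (u t) * Re l + Im (u t) * Im l)).
Proof.
  intros [H1 H2].
  apply (is_derive_ext (fun s => Re (u s) * Re (u s) + Im (u s) * Im (u s))).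
  - intros s. rewrite Cmod_sqr. simpl. ring.
  - replace (2 * (Re (u t) * Re l + Im (u t) * Im l)) with
      ((Re l * Re (u t) + Re (u t) * Re l) + (Im l * Im (u t) + Im (u t) * Im l)) by ring.
    apply @is_derive_plus; now apply is_derive_Rmult.
Qed.

Lemma Cauchy_Schwarz_C (z w : C) :
  Rabs (Re z * Re w + Im z * Im w) <= Cmod z * Cmod w.
Proof.
  replace (Re z * Re w + Im z * Im w) with (Re (Cmult z (Cconj w))) by (unfold Re, Im; simpl; ring).
  rewrite <- (Cmod_conj w), <- Cmod_mult. apply re_le_Cmod.
Qed.

Section Gronwall.
Variables (omega L M : R) (u du : R -> C).
Hypothesis hL : 0 <= L.
Hypothesis hM : 0 <= M.
Hypothesis hu : forall t, itv omega t -> cderiv u t (du t).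

Lemma gronwall_upper (t : R) :
  (forall s, itv omega s -> Cmod (du s) <= L * Cmod (u s) + M) ->
  itv omega t ->
  Cmod (u t) ^ 2 <= (Cmod (u 0) ^ 2 + M ^ 2 * t) * exp ((2 * L + 1) * t).
Proof.
  intros hdu [ht0 ht].
  set (N := fun s => Cmod (u s) ^ 2).
  set (dN := fun s => 2 * (Re (u s) * Re (du s) + Im (u s) * Im (du s))).
  assert (key : 0 - Cmod (u 0) ^ 2 * 1 <=
                M ^ 2 * t - Cmod (u t) ^ 2 * exp (- (2 * L + 1) * t)).
  { replace (0 - Cmod (u 0) ^ 2 * 1) with
      ((fun s => M ^ 2 * s - N s * exp (- (2 * L + 1) * s)) 0).
    2: { unfold N. rewrite !Rmult_0_r exp_0. ring. }
    apply (derive_monotone (fun s => M ^ 2 * s - N s * exp (- (2 * L + 1) * s))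
      (fun s => M ^ 2 - (dN s * exp (- (2 * L + 1) * s)
                + N s * (- (2 * L + 1) * exp (- (2 * L + 1) * s))))); [exact ht0 | |].
    - intros s hs. apply @is_derive_minus.
      + auto_derive; trivial. ring.
      + apply (is_derive_Rmult N (fun s => exp (- (2 * L + 1) * s))).
        * apply cderiv_norm2, hu. unfold itv; lra.
        * auto_derive; trivial. ring.
    - intros s hs.
      assert (hs' : itv omega s) by (unfold itv; lra).
      pose proof (Cauchy_Schwarz_C (u s) (du s)) as cs. apply Rabs_le_between in cs.
      specialize (hdu s hs').
      pose proof (Cmod_ge_0 (u s)). pose proof (Cmod_ge_0 (du s)).
      assert (hb : dN s <= (2 * L + 1) * N s + M ^ 2).
      { unfold dN, N.
        pose proof (Rmult_le_compat_l _ _ _ H hdu).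
        pose proof (pow2_ge_0 (Cmod (u s) - M)). nra. }
      assert (he : exp (- (2 * L + 1) * s) <= 1).
      { apply Rle_trans with (exp 0); [apply exp_le_compat; nra | rewrite exp_0; lra]. }
      pose proof (exp_pos (- (2 * L + 1) * s)).
      assert (0 <= M ^ 2) by nra. nra. }
  replace (Cmod (u t) ^ 2)
    with (Cmod (u t) ^ 2 * exp (- (2 * L + 1) * t) * exp ((2 * L + 1) * t)).
  2: { rewrite Rmult_assoc -exp_plus.
       replace (- (2 * L + 1) * t + (2 * L + 1) * t) with 0 by ring.
       rewrite exp_0. ring. }
  apply Rmult_le_compat_r; [left; apply exp_pos | lra].
Qed.

(** Since |u|^2 decays at most like exp (- 2 L t), a zero of [u] at any time forces [u 0] to vanish.
    This gives uniqueness backward in time and the non-vanishing of solutions. *)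
Lemma gronwall_lower (t : R) :
  (forall s, itv omega s -> Cmod (du s) <= L * Cmod (u s)) ->
  itv omega t ->
  Cmod (u 0) ^ 2 <= Cmod (u t) ^ 2 * exp (2 * L * t).
Proof.
  intros hdu [ht0 ht].
  set (N := fun s => Cmod (u s) ^ 2).
  set (dN := fun s => 2 * (Re (u s) * Re (du s) + Im (u s) * Im (du s))).
  replace (Cmod (u 0) ^ 2) with ((fun s => N s * exp (2 * L * s)) 0).
  2: { unfold N. rewrite Rmult_0_r exp_0. ring. }
  apply (derive_monotone (fun s => N s * exp (2 * L * s))
      (fun s => dN s * exp (2 * L * s) + N s * (2 * L * exp (2 * L * s)))); [exact ht0 | |].
  - intros s hs. apply (is_derive_Rmult N (fun s => exp (2 * L * s))).
    + apply cderiv_norm2, hu. unfold itv; lra.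
    + auto_derive; trivial. ring.
  - intros s hs.
    assert (hs' : itv omega s) by (unfold itv; lra).
    pose proof (Cauchy_Schwarz_C (u s) (du s)) as cs. apply Rabs_le_between in cs.
    specialize (hdu s hs').
    pose proof (Cmod_ge_0 (u s)). pose proof (Cmod_ge_0 (du s)).
    assert (hb : 0 <= dN s + 2 * L * N s).
    { unfold dN, N. pose proof (Rmult_le_compat_l _ _ _ H hdu). nra. }
    pose proof (exp_pos (2 * L * s)). nra.
Qed.
End Gronwall.

(** * One-sided derivatives at the endpoints *)

Lemma norm_C_R (z : C) : @norm R_AbsRing C_R_NormedModule z = Cmod z.
Proof.
  destruct z as [x y]. unfold Cmod, norm; simpl. unfold prod_norm; simpl.
  unfold norm; simpl. unfold abs; simpl. f_equal.
  rewrite !Rmult_1_r. rewrite <- !Rabs_mult, !Rabs_pos_eq by nra. reflexivity.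
Qed.

Lemma ndist_C (z w : C) : ndist (V := C_R_NormedModule) z w = Cmod (Cminus z w).
Proof. apply norm_C_R. Qed.

Lemma scal_C_R (k : R) (z : C) : scal (V := C_R_NormedModule) k z = Cmult (RtoC k) z.
Proof. apply C_eq; unfold Re, Im; simpl; unfold scal; simpl; unfold mult; simpl; ring. Qed.

Lemma is_derive_itv_eps (omega : R) (z : R -> C) (t : R) (l : C) :
  itv omega t -> is_derive_itv omega z t l ->
  forall eps : R, 0 < eps -> exists delta : R, 0 < delta /\
    forall s, itv omega s -> Rabs (s - t) < delta ->
      Cmod (Cminus (Cminus (z s) (z t)) (Cmult (RtoC (s - t)) l)) <= eps * Rabs (s - t).
Proof.
  intros ht [_ H] eps he.
  destruct (H t) with (eps := mkposreal _ he) as [d hd].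
  { intros P [d hd]. exists d. intros s hs _. now apply hd. }
  exists d. split; [apply d |]. intros s hs1 hs2.
  specialize (hd s hs2 hs1). simpl in hd. rewrite norm_C_R scal_C_R in hd.
  exact hd.
Qed.


Lemma is_derive_C_R_eps (z : R -> C) (t : R) (l : C) :
  is_derive (V := C_R_NormedModule) z t l ->
  forall eps : R, 0 < eps -> exists delta : R, 0 < delta /\
    forall s, Rabs (s - t) < delta ->
      Cmod (Cminus (Cminus (z s) (z t)) (Cmult (RtoC (s - t)) l)) <= eps * Rabs (s - t).
Proof.
  intros [_ H] eps he.
  destruct (H t) with (eps := mkposreal _ he) as [d hd].
  { intros P hP. exact hP. }
  exists d. split; [apply d |]. intros s hs.
  specialize (hd s hs). simpl in hd. rewrite norm_C_R scal_C_R in hd.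
  exact hd.
Qed.

Lemma is_derive_of_eps (f : R -> R) (t l : R) :
  (forall eps : R, 0 < eps -> exists delta : R, 0 < delta /\
    forall s, Rabs (s - t) < delta -> Rabs (f s - f t - (s - t) * l) <= eps * Rabs (s - t)) ->
  is_derive f t l.
Proof.
  intros H. apply is_derive_Reals. intros eps he.
  destruct (H (eps / 2)) as [d [hd hs]]; [lra |].
  exists (mkposreal d hd). intros h hh hhd. simpl in hhd.
  specialize (hs (t + h)). replace (t + h - t) with h in hs by ring.
  specialize (hs hhd).
  replace ((f (t + h) - f t) / h - l) with ((f (t + h) - f t - h * l) / h) by (field; exact hh).
  unfold Rdiv. rewrite Rabs_mult Rabs_inv.
  pose proof (Rabs_pos_lt h hh).
  apply Rle_lt_trans with (eps / 2 * Rabs h * / Rabs h).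
  - apply Rmult_le_compat_r; [left; now apply Rinv_0_lt_compat | exact hs].
  - rewrite Rmult_assoc Rinv_r; lra.
Qed.

Lemma cderiv_of_eps (z : R -> C) (t : R) (l : C) :
  (forall eps : R, 0 < eps -> exists delta : R, 0 < delta /\
    forall s, Rabs (s - t) < delta ->
      Cmod (Cminus (Cminus (z s) (z t)) (Cmult (RtoC (s - t)) l)) <= eps * Rabs (s - t)) ->
  cderiv z t l.
Proof.
  intros H; split; apply is_derive_of_eps; intros eps he;
    destruct (H eps he) as [d [hd hs]]; exists d; (split; [exact hd |]);
    intros s hh; specialize (hs s hh).
  - eapply Rle_trans; [| exact hs]. eapply Rle_trans; [| apply re_le_Cmod].
    right. f_equal. unfold Re, Im; simpl; ring.
  - eapply Rle_trans; [| exact hs]. eapply Rle_trans; [| apply im_le_Cmod].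
    right. f_equal. unfold Re, Im; simpl; ring.
Qed.

Lemma is_derive_eps (f : R -> R) (t l : R) :
  is_derive f t l ->
  forall eps : R, 0 < eps -> exists delta : R, 0 < delta /\
    forall s, Rabs (s - t) < delta -> Rabs (f s - f t - (s - t) * l) <= eps * Rabs (s - t).
Proof.
  intros [_ H] eps he.
  destruct (H t) with (eps := mkposreal _ he) as [d hd].
  { intros P hP. exact hP. }
  exists d. split; [apply d |]. intros s hs. exact (hd s hs).
Qed.

Lemma cderiv_eps (z : R -> C) (t : R) (l : C) :
  cderiv z t l ->
  forall eps : R, 0 < eps -> exists delta : R, 0 < delta /\
    forall s, Rabs (s - t) < delta ->
      Cmod (Cminus (Cminus (z s) (z t)) (Cmult (RtoC (s - t)) l)) <= eps * Rabs (s - t).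
Proof.
  intros [H1 H2] eps he.
  destruct (is_derive_eps _ _ _ H1 (eps / 2)) as [d1 [hd1 k1]]; [lra |].
  destruct (is_derive_eps _ _ _ H2 (eps / 2)) as [d2 [hd2 k2]]; [lra |].
  exists (Rmin d1 d2). split; [now apply Rmin_pos |]. intros s hs.
  specialize (k1 s (Rlt_le_trans _ _ _ hs (Rmin_l _ _))).
  specialize (k2 s (Rlt_le_trans _ _ _ hs (Rmin_r _ _))).
  eapply Rle_trans; [apply Cmod_le_Re_Im |].
  replace (Re (z s - z t - RtoC (s - t) * l)%C) with (Re (z s) - Re (z t) - (s - t) * Re l)
    by (unfold Re, Im; simpl; ring).
  replace (Im (z s - z t - RtoC (s - t) * l)%C) with (Im (z s) - Im (z t) - (s - t) * Im l)
    by (unfold Re, Im; simpl; ring).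
  lra.
Qed.

Lemma is_derive_itv_of_cderiv (omega : R) (z : R -> C) (t : R) (l : C) :
  itv omega t -> cderiv z t l -> is_derive_itv omega z t l.
Proof.
  intros ht H. split; [apply (@is_linear_scal_l R_AbsRing C_R_NormedModule) |].
  intros x hx.
  assert (e : x = t).
  { apply NNPP; intros hne.
    assert (hp : 0 < Rabs (x - t)) by (apply Rabs_pos_lt; lra).
    specialize (hx (ball x (mkposreal _ hp)) (locally_ball x _)).
    destruct hx as [d hd]. specialize (hd t (ball_center t d) ht).
    apply (Rlt_irrefl (Rabs (x - t))). rewrite {1}Rabs_minus_sym. exact hd. }
  subst x. intros eps.
  destruct (cderiv_eps z t l H eps (cond_pos eps)) as [d [hd hs]].
  exists (mkposreal d hd). intros s hh _. rewrite norm_C_R scal_C_R. exact (hs s hh).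
Qed.

(** Continuing [z] beyond each endpoint along its tangent turns the one-sided derivatives into
    two-sided ones and changes nothing on the interval. *)
Lemma is_derive_itv_extend (omega : R) (z : R -> C) (l : R -> C) :
  0 < omega -> (forall t, itv omega t -> is_derive_itv omega z t (l t)) ->
  exists Z : R -> C, (forall t, itv omega t -> Z t = z t) /\
    (forall t, itv omega t -> cderiv Z t (l t)).
Proof.
  intros hw H. set (p := clamp omega).
  exists (fun t => Cplus (z (p t)) (Cmult (RtoC (t - p t)) (l (p t)))). split.
  - intros t ht. unfold p. rewrite (clamp_id omega t ht).
    replace (t - t) with 0 by ring. ring.
  - intros t ht. apply cderiv_of_eps. intros eps he.
    destruct (is_derive_itv_eps _ _ _ _ ht (H t ht) eps he) as [d [hd hs]].
    destruct ht as [ht0 ht1].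
    (* These radii keep [s] from leaving the interval through an endpoint other than [t]; the value
       1 is arbitrary. *)
    assert (hd1 : exists d1, 0 < d1 /\ (t = 0 \/ d1 <= t)).
    { destruct (Req_dec t 0); [exists 1 | exists t]; lra. }
    assert (hd2 : exists d2, 0 < d2 /\ (t = omega \/ d2 <= omega - t)).
    { destruct (Req_dec t omega); [exists 1 | exists (omega - t)]; lra. }
    destruct hd1 as [d1 [h1 h1']]. destruct hd2 as [d2 [h2 h2']].
    exists (Rmin d (Rmin d1 d2)). split; [now repeat apply Rmin_pos |].
    intros s hh.
    assert (k0 : Rabs (s - t) < d) by (eapply Rlt_le_trans; [exact hh | apply Rmin_l]).
    assert (k1 : Rabs (s - t) < d1).
    { eapply Rlt_le_trans; [exact hh |]. eapply Rle_trans; [apply Rmin_r | apply Rmin_l]. }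
    assert (k2 : Rabs (s - t) < d2).
    { eapply Rlt_le_trans; [exact hh |]. eapply Rle_trans; [apply Rmin_r | apply Rmin_r]. }
    assert (pt : p t = t) by (apply clamp_id; split; assumption).
    assert (hc : Rabs (p s - t) <= Rabs (s - t)).
    { rewrite <- pt at 1. now apply clamp_lip. }
    (* Either [s] stays in the interval, or [t] is the endpoint onto which [s] is projected and the
       tangent piece has slope exactly [l t]. *)
    assert (hcase : p s = s \/ p s = t).
    { apply Rabs_lt_between in k1, k2. unfold p, clamp, Rmax, Rmin.
      repeat destruct Rle_dec; lra. }
    specialize (hs (p s) (clamp_itv omega hw s) (Rle_lt_trans _ _ _ hc k0)).
    rewrite pt.
    replace (z (p s) + RtoC (s - p s) * l (p s) - (z t + RtoC (t - t) * l t)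
             - RtoC (s - t) * l t)%C
      with (z (p s) - z t - RtoC (p s - t) * l t)%C.
    + eapply Rle_trans; [exact hs |]. apply Rmult_le_compat_l; lra.
    + destruct hcase as [e | e]; rewrite e; rewrite !RtoC_minus; ring.
Qed.

(** * The vector field and uniqueness *)

Definition ccont (z : R -> C) (t : R) : Prop :=
  continuous (fun s => Re (z s)) t /\ continuous (fun s => Im (z s)) t.

Lemma ccont_const (c : C) (t : R) : ccont (fun _ => c) t.
Proof. split; apply continuous_const. Qed.

Lemma ccont_real (f : R -> R) (t : R) : continuous f t -> ccont (fun s => RtoC (f s)) t.
Proof. intros H; split; [exact H | apply (continuous_const 0)]. Qed.

Lemma ccont_plus (z w : R -> C) (t : R) :
  ccont z t -> ccont w t -> ccont (fun s => Cplus (z s) (w s)) t.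
Proof.
  intros [H1 H2] [H3 H4]; split.
  - exact (@continuous_plus R_UniformSpace R_AbsRing R_NormedModule _ _ t H1 H3).
  - exact (@continuous_plus R_UniformSpace R_AbsRing R_NormedModule _ _ t H2 H4).
Qed.

Lemma continuous_Rmult (f g : R -> R) (t : R) :
  continuous f t -> continuous g t -> continuous (fun s => f s * g s) t.
Proof. intros H1 H2. exact (@continuous_mult R_UniformSpace R_AbsRing _ _ t H1 H2). Qed.

Lemma ccont_mult (z w : R -> C) (t : R) :
  ccont z t -> ccont w t -> ccont (fun s => Cmult (z s) (w s)) t.
Proof.
  intros [H1 H2] [H3 H4]; split.
  - apply (@continuous_minus R_UniformSpace R_AbsRing R_NormedModule
             (fun s => Re (z s) * Re (w s)) (fun s => Im (z s) * Im (w s)) t);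
      now apply continuous_Rmult.
  - apply (@continuous_plus R_UniformSpace R_AbsRing R_NormedModule
             (fun s => Re (z s) * Im (w s)) (fun s => Im (z s) * Re (w s)) t);
      now apply continuous_Rmult.
Qed.

Lemma ccont_pow (z : R -> C) (t : R) (n : nat) :
  ccont z t -> ccont (fun s => Cpow (z s) n) t.
Proof.
  intros H. induction n as [|n IH]; [apply (ccont_const (RtoC 1)) |].
  now apply (ccont_mult z (fun s => Cpow (z s) n)).
Qed.

Lemma ccont_comp (z : R -> C) (f : R -> R) (t : R) :
  continuous f t -> ccont z (f t) -> ccont (fun s => z (f s)) t.
Proof.
  intros H [H1 H2]; split.
  - exact (continuous_comp f (fun s => Re (z s)) t H H1).
  - exact (continuous_comp f (fun s => Im (z s)) t H H2).
Qed.

Lemma cderiv_ccont (z : R -> C) (t : R) (l : C) : cderiv z t l -> ccont z t.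
Proof.
  intros [H1 H2]; split; apply (@ex_derive_continuous R_AbsRing R_NormedModule).
  - now exists (Re l).
  - now exists (Im l).
Qed.

Lemma ccont_continuous (z : R -> C) (t : R) :
  ccont z t -> continuous (T := R_UniformSpace) (U := C_R_NormedModule) z t.
Proof.
  intros [H1 H2]. apply (proj2 (continuous_ndist_iff (V := C_R_NormedModule) z t)).
  intros eps he. assert (he2 : 0 < eps / 2) by lra.
  pose proof (proj1 (continuous_ndist_iff (V := R_NormedModule) _ t) H1 _ he2) as K1.
  pose proof (proj1 (continuous_ndist_iff (V := R_NormedModule) _ t) H2 _ he2) as K2.
  apply: filter_imp (filter_and _ _ K1 K2) => s [k1 k2].
  rewrite ndist_C. eapply Rle_lt_trans; [apply Cmod_le_Re_Im |].
  change (Rabs (Re (z s) - Re (z t)) < eps / 2) in k1.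
  change (Rabs (Im (z s) - Im (z t)) < eps / 2) in k2.
  change (Rabs (Re (z s) - Re (z t)) + Rabs (Im (z s) - Im (z t)) < eps). lra.
Qed.

Lemma continuous_bounded_itv (omega : R) (f : R -> R) :
  0 < omega -> (forall t, itv omega t -> continuous f t) ->
  exists M, 0 <= M /\ forall t, itv omega t -> Rabs (f t) <= M.
Proof.
  intros hw hf.
  destruct (continuity_ab_maj (fun t => Rabs (f t)) 0 omega) as [m [hm _]]; [lra | |].
  - intros t ht. apply continuity_pt_filterlim.
    apply (continuous_comp f Rabs); [now apply hf | apply continuous_Rabs].
  - exists (Rabs (f m)). split; [apply Rabs_pos | exact hm].
Qed.

Lemma ccont_bounded_itv (omega : R) (z : R -> C) :
  0 < omega -> (forall t, itv omega t -> ccont z t) ->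
  exists M, 0 <= M /\ forall t, itv omega t -> Cmod (z t) <= M.
Proof.
  intros hw hz.
  destruct (continuous_bounded_itv omega (fun t => Re (z t)) hw) as [M1 [h1 k1]];
    [apply hz |].
  destruct (continuous_bounded_itv omega (fun t => Im (z t)) hw) as [M2 [h2 k2]];
    [apply hz |].
  exists (M1 + M2). split; [lra |]. intros t ht.
  eapply Rle_trans; [apply Cmod_le_Re_Im |]. specialize (k1 t ht); specialize (k2 t ht). lra.
Qed.

Lemma cont_itv_clamp (omega : R) (f : R -> R) :
  0 < omega -> cont_itv omega f -> forall t, continuous (fun s => f (clamp omega s)) t.
Proof.
  intros hw hf t.
  specialize (hf (clamp omega t) (clamp_itv omega hw t)).
  intros P hP. destruct (hf P hP) as [d hd]. exists d. intros s hs.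
  apply hd; [| now apply clamp_itv].
  eapply Rle_lt_trans; [apply (clamp_lip omega hw) | exact hs].
Qed.

Definition vf (n : nat) (a b : R) (z : C) : C :=
  Cplus (Cplus (Cpow z n) (Cmult (RtoC a) (Cpow z (n - 1)))) (Cmult (RtoC b) (Cpow z (n - 2))).

Definition sol (n : nat) (omega : R) (a b : R -> R) (z : R -> C) : Prop :=
  forall t, itv omega t -> cderiv z t (vf n (a t) (b t) (z t)).

Lemma is_solution_extend (n : nat) (omega : R) (a b : R -> R) (z : R -> C) :
  0 < omega -> is_solution n omega a b z ->
  exists Z, (forall t, itv omega t -> Z t = z t) /\ sol n omega a b Z.
Proof.
  intros hw H.
  destruct (is_derive_itv_extend omega z (fun t => vf n (a t) (b t) (z t)) hw H)
    as [Z [h1 h2]].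
  exists Z. split; [exact h1 |]. intros t ht. rewrite (h1 t ht). now apply h2.
Qed.

Lemma sol_is_solution (n : nat) (omega : R) (a b : R -> R) (z : R -> C) :
  sol n omega a b z -> is_solution n omega a b z.
Proof. intros H t ht. apply is_derive_itv_of_cderiv; [exact ht | now apply H]. Qed.

Lemma sol_bounded (n : nat) (omega : R) (a b : R -> R) (z : R -> C) :
  0 < omega -> sol n omega a b z ->
  exists M, 0 <= M /\ forall t, itv omega t -> Cmod (z t) <= M.
Proof.
  intros hw H. apply ccont_bounded_itv; [exact hw |].
  intros t ht. eapply cderiv_ccont, H, ht.
Qed.

Lemma Cmod_pow_le (M : R) (x : C) (k : nat) : Cmod x <= M -> Cmod (Cpow x k) <= M ^ k.
Proof. intros h. rewrite Cmod_pow. apply pow_incr. split; [apply Cmod_ge_0 | exact h]. Qed.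

Lemma Cmod_minus_le (x y : C) : Cmod (Cminus x y) <= Cmod x + Cmod y.
Proof.
  unfold Cminus. eapply Rle_trans; [apply Cmod_triangle |]. rewrite Cmod_opp. lra.
Qed.

Lemma Cpow_lipschitz (M : R) (k : nat) : 0 <= M ->
  exists K, 0 <= K /\ forall x y, Cmod x <= M -> Cmod y <= M ->
    Cmod (Cminus (Cpow x k) (Cpow y k)) <= K * Cmod (Cminus x y).
Proof.
  intros hM. induction k as [|k [K [hK IH]]].
  - exists 0. split; [lra |]. intros x y _ _. simpl.
    replace (1 - 1)%C with (RtoC 0) by ring. rewrite Cmod_0. lra.
  - exists (M * K + M ^ k). split.
    { pose proof (pow_le M k hM). nra. }
    intros x y hx hy.
    replace (Cminus (Cpow x (S k)) (Cpow y (S k)))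
      with (x * (Cpow x k - Cpow y k) + (x - y) * Cpow y k)%C by (simpl; ring).
    eapply Rle_trans; [apply Cmod_triangle |]. rewrite !Cmod_mult.
    pose proof (Cmod_pow_le M y k hy). specialize (IH x y hx hy).
    pose proof (Cmod_ge_0 (x - y)). pose proof (Cmod_ge_0 x).
    pose proof (Cmod_ge_0 (Cpow x k - Cpow y k)).
    assert (Cmod x * Cmod (Cpow x k - Cpow y k) <= M * (K * Cmod (x - y))).
    { apply Rmult_le_compat; assumption. }
    assert (Cmod (x - y) * Cmod (Cpow y k) <= Cmod (x - y) * M ^ k).
    { apply Rmult_le_compat_l; assumption. }
    lra.
Qed.

Lemma vf_lipschitz (n : nat) (A M : R) : 0 <= A -> 0 <= M ->
  exists K, 0 < K /\ forall a b x y, Rabs a <= A -> Rabs b <= A ->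
    Cmod x <= M -> Cmod y <= M ->
    Cmod (Cminus (vf n a b x) (vf n a b y)) <= K * Cmod (Cminus x y).
Proof.
  intros hA hM.
  destruct (Cpow_lipschitz M n hM) as [K1 [h1 k1]].
  destruct (Cpow_lipschitz M (n - 1) hM) as [K2 [h2 k2]].
  destruct (Cpow_lipschitz M (n - 2) hM) as [K3 [h3 k3]].
  (* The summand 1 makes the constant strictly positive, as the Picard iteration requires of its
     Lipschitz constant. *)
  exists (K1 + A * K2 + A * K3 + 1). split; [nra |].
  intros a b x y ha hb hx hy. unfold vf.
  specialize (k1 x y hx hy); specialize (k2 x y hx hy); specialize (k3 x y hx hy).
  match goal with |- Cmod ?e <= _ => replace e with
    ((Cpow x n - Cpow y n) + RtoC a * (Cpow x (n - 1) - Cpow y (n - 1))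
      + RtoC b * (Cpow x (n - 2) - Cpow y (n - 2)))%C by ring end.
  eapply Rle_trans; [apply Cmod_triangle |].
  eapply Rle_trans; [apply Rplus_le_compat_r, Cmod_triangle |].
  rewrite !Cmod_mult !Cmod_R.
  pose proof (Cmod_ge_0 (x - y)).
  pose proof (Rmult_le_compat _ _ _ _ (Rabs_pos a) (Cmod_ge_0 _) ha k2).
  pose proof (Rmult_le_compat _ _ _ _ (Rabs_pos b) (Cmod_ge_0 _) hb k3).
  lra.
Qed.

Definition bounded_itv (omega : R) (f : R -> R) (A : R) : Prop :=
  forall t, itv omega t -> Rabs (f t) <= A.

Lemma sol_unique (n : nat) (omega A : R) (a b : R -> R) (z w : R -> C) (t0 : R) :
  0 < omega -> 0 <= A -> bounded_itv omega a A -> bounded_itv omega b A ->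
  sol n omega a b z -> sol n omega a b w ->
  itv omega t0 -> z t0 = w t0 -> forall t, itv omega t -> z t = w t.
Proof.
  intros hw hA ha hb hz hw' ht0 e.
  destruct (sol_bounded _ _ _ _ _ hw hz) as [M1 [m1 b1]].
  destruct (sol_bounded _ _ _ _ _ hw hw') as [M2 [m2 b2]].
  destruct (vf_lipschitz n A (M1 + M2)) as [K [hK k]]; [lra | lra |].
  set (u := fun t => Cminus (z t) (w t)).
  set (du := fun t => Cminus (vf n (a t) (b t) (z t)) (vf n (a t) (b t) (w t))).
  assert (hu : forall t, itv omega t -> cderiv u t (du t)).
  { intros t ht. apply cderiv_minus; [now apply hz | now apply hw']. }
  assert (hd : forall t, itv omega t -> Cmod (du t) <= K * Cmod (u t)).
  { intros t ht. specialize (b1 t ht). specialize (b2 t ht).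
    apply k; [now apply ha | now apply hb | lra | lra]. }
  (* The lower estimate goes back from [t0] to 0; the upper one then goes forward from 0 to [t]. *)
  assert (u0 : Cmod (u 0) = 0).
  { pose proof (gronwall_lower omega K u du hu t0 hd ht0) as G.
    replace (u t0) with (RtoC 0) in G by (unfold u; rewrite e; ring).
    rewrite Cmod_0 in G. pose proof (Cmod_ge_0 (u 0)). nra. }
  intros t ht.
  assert (G : Cmod (u t) ^ 2 <= (Cmod (u 0) ^ 2 + 0 ^ 2 * t) * exp ((2 * K + 1) * t)).
  { apply (gronwall_upper omega K 0 u du); try lra; try assumption.
    intros s hs. rewrite Rplus_0_r. now apply hd. }
  rewrite u0 in G.
  assert (ut : Cmod (u t) = 0).
  { pose proof (Cmod_ge_0 (u t)). apply Rsqr_0_uniq. rewrite Rsqr_pow2.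
    pose proof (pow2_ge_0 (Cmod (u t))). simpl in G |- *. lra. }
  apply Cmod_eq_0 in ut. unfold u in ut.
  replace (z t) with ((z t - w t) + w t)%C by ring. rewrite ut. ring.
Qed.

(** * Clipping the argument of the field *)

Definition clip (r x : R) : R := Rmax (- r) (Rmin x r).

(** Clipping each coordinate separately is 1-Lipschitz, fixes the disc of radius r and commutes with
    conjugation, so the truncated equation keeps the conjugation symmetry of the original one. *)
Definition cclip (r : R) (z : C) : C := (clip r (Re z), clip r (Im z)).

Lemma clip_abs (r x : R) : 0 <= r -> Rabs (clip r x) <= r.
Proof.
  intros hr. apply Rabs_le. unfold clip, Rmax, Rmin; repeat destruct Rle_dec; lra.
Qed.

Lemma clip_id (r x : R) : Rabs x <= r -> clip r x = x.
Proof.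
  intros h. apply Rabs_le_between in h.
  unfold clip, Rmax, Rmin; repeat destruct Rle_dec; lra.
Qed.

Lemma clip_ge (r x : R) : 0 <= r -> r <= x -> clip r x = r.
Proof. intros h0 h. unfold clip, Rmax, Rmin; repeat destruct Rle_dec; lra. Qed.

Lemma clip_opp (r x : R) : 0 <= r -> clip r (- x) = - clip r x.
Proof. intros h0. unfold clip, Rmax, Rmin; repeat destruct Rle_dec; lra. Qed.

Lemma clip_lip (r x y : R) : 0 <= r -> Rabs (clip r x - clip r y) <= Rabs (x - y).
Proof.
  intros h. unfold clip, Rmax, Rmin, Rabs; repeat destruct Rle_dec; repeat destruct Rcase_abs; lra.
Qed.

Lemma cclip_bound (r : R) (z : C) : 0 <= r -> Cmod (cclip r z) <= 2 * r.
Proof.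
  intros hr. eapply Rle_trans; [apply Cmod_le_Re_Im |]. unfold cclip, Re, Im; simpl.
  pose proof (clip_abs r (fst z) hr). pose proof (clip_abs r (snd z) hr). lra.
Qed.

Lemma cclip_id (r : R) (z : C) : Cmod z <= r -> cclip r z = z.
Proof.
  intros h. unfold cclip. rewrite !clip_id.
  - now destruct z.
  - eapply Rle_trans; [apply im_le_Cmod | exact h].
  - eapply Rle_trans; [apply re_le_Cmod | exact h].
Qed.

Lemma cclip_lip (r : R) (z w : C) : 0 <= r ->
  Cmod (Cminus (cclip r z) (cclip r w)) <= Cmod (Cminus z w).
Proof.
  intros hr. apply Rsqr_incr_0_var; [| apply Cmod_ge_0].
  rewrite !Rsqr_pow2 !Cmod_sqr.
  pose proof (clip_lip r (Re z) (Re w) hr) as h1.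
  pose proof (clip_lip r (Im z) (Im w) hr) as h2.
  apply Rplus_le_compat; rewrite <- !Rsqr_pow2; apply Rsqr_le_abs_1;
    [exact h1 | exact h2].
Qed.

Lemma cclip_conj (r : R) (z : C) : 0 <= r -> cclip r (Cconj z) = Cconj (cclip r z).
Proof. intros h. unfold cclip, Cconj; simpl. now rewrite clip_opp. Qed.

Lemma vf_conj (n : nat) (a b : R) (z : C) : vf n a b (Cconj z) = Cconj (vf n a b z).
Proof.
  unfold vf. rewrite !Cplus_conj !Cmult_conj !Cpow_conj.
  replace (Cconj (RtoC a)) with (RtoC a) by (apply C_eq; unfold Re, Im; simpl; ring).
  replace (Cconj (RtoC b)) with (RtoC b) by (apply C_eq; unfold Re, Im; simpl; ring).
  reflexivity.
Qed.

(** * Global flows and perturbation *)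

(** The constant [G] is chosen before [u] and [M], because it has to serve whole families of
    solutions indexed by their initial values. *)
Lemma gronwall_bound (omega L : R) : 0 < omega -> 0 <= L ->
  exists G, 1 <= G /\ forall (u du : R -> C) (M : R), 0 <= M ->
    (forall t, itv omega t -> cderiv u t (du t)) ->
    (forall t, itv omega t -> Cmod (du t) <= L * Cmod (u t) + M) ->
    forall t, itv omega t -> Cmod (u t) <= G * (Cmod (u 0) + M).
Proof.
  intros hw hL. set (E := exp ((2 * L + 1) * omega)).
  assert (hE : 1 <= E).
  { unfold E. pose proof (exp_ineq1_le ((2 * L + 1) * omega)). nra. }
  (* As (1 + omega) E >= 1, this number dominates its own square root, which is what the bound on
     |u|^2 would give. *)
  exists ((1 + omega) * E). split; [nra |].
  intros u du M hM hu hd t ht.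
  pose proof (gronwall_upper omega L M u du hL hu t hd ht) as H.
  pose proof (Cmod_ge_0 (u 0)) as h0. pose proof (Cmod_ge_0 (u t)) as h1.
  assert (hEt : exp ((2 * L + 1) * t) <= E).
  { apply exp_le_compat. destruct ht. nra. }
  set (c := Cmod (u 0)) in *. destruct ht as [t0 t1].
  assert (k1 : c ^ 2 + M ^ 2 * t <= (1 + omega) * (c + M) ^ 2).
  { pose proof (pow2_ge_0 M). pose proof (pow2_ge_0 c).
    pose proof (Rmult_le_pos c M h0 hM) as hcM.
    pose proof (Rmult_le_pos _ _ (Rlt_le _ _ hw) hcM).
    pose proof (Rmult_le_compat_l _ _ _ H0 t1).
    pose proof (Rmult_le_pos _ _ (Rlt_le _ _ hw) H1). nra. }
  assert (hE1 : 1 <= (1 + omega) * E) by nra.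
  apply Rsqr_incr_0_var; [| apply Rmult_le_pos; lra]. rewrite !Rsqr_pow2.
  eapply Rle_trans; [exact H |].
  apply Rle_trans with ((1 + omega) * (c + M) ^ 2 * E).
  - apply Rmult_le_compat; [| left; apply exp_pos | exact k1 | exact hEt].
    pose proof (pow2_ge_0 M). pose proof (pow2_ge_0 c). nra.
  - pose proof (pow2_ge_0 (c + M)).
    assert ((1 + omega) * E <= ((1 + omega) * E) ^ 2) by nra.
    replace (((1 + omega) * E * (c + M)) ^ 2) with (((1 + omega) * E) ^ 2 * (c + M) ^ 2) by ring.
    nra.
Qed.

Lemma picard_C (omega L : R) (F : R -> C -> C) (c : C) :
  0 < omega -> 0 < L ->
  (forall t x y, Cmod (Cminus (F t x) (F t y)) <= L * Cmod (Cminus x y)) ->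
  (forall x t, ccont (fun s => F s x) t) ->
  exists z : R -> C, z 0 = c /\ forall t, itv omega t -> cderiv z t (F t (z t)).
Proof.
  intros hw hL hF hc.
  destruct (picard_lindelof C_R_CompleteNormedModule omega L F c hw hL) as [z [h0 hz]].
  - intros t x y.
    change (ndist (V := C_R_NormedModule) (F t x) (F t y) <= L * ndist (V := C_R_NormedModule) x y).
    rewrite !ndist_C. apply hF.
  - intros x t. exact (ccont_continuous _ _ (hc x t)).
  - exists z. split; [exact h0 |]. intros t ht.
    apply cderiv_of_eps, is_derive_C_R_eps, hz, ht.
Qed.

Lemma linear_flow (omega P : R) (p q : R -> C) (c : C) :
  0 < omega -> (forall t, ccont p t) -> (forall t, ccont q t) ->
  (forall t, Cmod (p t) <= P) ->
  exists u : R -> C, u 0 = c /\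
    forall t, itv omega t -> cderiv u t (Cplus (Cmult (p t) (u t)) (q t)).
Proof.
  intros hw hp hq hP.
  assert (0 <= P) by (eapply Rle_trans; [apply Cmod_ge_0 | apply (hP 0)]).
  apply (picard_C omega (P + 1) (fun t x => Cplus (Cmult (p t) x) (q t))); [exact hw | lra | |].
  - intros t x y.
    replace (Cminus (p t * x + q t) (p t * y + q t)) with (Cmult (p t) (x - y)) by ring.
    rewrite Cmod_mult. apply Rmult_le_compat_r; [apply Cmod_ge_0 | specialize (hP t); lra].
  - intros x t. apply ccont_plus; [apply ccont_mult; [apply hp | apply ccont_const] | apply hq].
Qed.

Lemma ccont_vf (n : nat) (a b : R -> R) (z : R -> C) (t : R) :
  continuous a t -> continuous b t -> ccont z t ->
  ccont (fun s => vf n (a s) (b s) (z s)) t.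
Proof.
  intros ha hb hz. unfold vf.
  apply ccont_plus; [apply ccont_plus |].
  - now apply ccont_pow.
  - apply ccont_mult; [now apply ccont_real | now apply ccont_pow].
  - apply ccont_mult; [now apply ccont_real | now apply ccont_pow].
Qed.

Lemma trunc_flow (n : nat) (omega A r : R) (a b : R -> R) :
  0 < omega -> 0 <= r ->
  (forall t, continuous a t) -> (forall t, continuous b t) ->
  (forall t, Rabs (a t) <= A) -> (forall t, Rabs (b t) <= A) ->
  forall c : C, exists z : R -> C, z 0 = c /\
    forall t, itv omega t -> cderiv z t (vf n (a t) (b t) (cclip r (z t))).
Proof.
  intros hw hr ha hb hA hB c.
  assert (0 <= A) by (eapply Rle_trans; [apply Rabs_pos | apply (hA 0)]).
  destruct (vf_lipschitz n A (2 * r)) as [K [hK k]]; [lra | lra |].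
  apply (picard_C omega K (fun t x => vf n (a t) (b t) (cclip r x))); [exact hw | lra | |].
  - intros t x y.
    eapply Rle_trans; [apply k; auto using cclip_bound |].
    apply Rmult_le_compat_l; [lra | now apply cclip_lip].
  - intros x t. apply ccont_vf; auto. apply ccont_const.
Qed.

Section Perturbation.
Variables (n : nat) (omega A : R) (a b : R -> R) (phi : R -> C).
Hypothesis homega : 0 < omega.
Hypothesis a_cont : forall t, continuous a t.
Hypothesis b_cont : forall t, continuous b t.
Hypothesis a_bd : forall t, Rabs (a t) <= A.
Hypothesis b_bd : forall t, Rabs (b t) <= A.
Hypothesis hphi : sol n omega a b phi.

(** The field is clipped at level M + 1, where M bounds [phi]. A clipped solution starting within 1
    / G of [phi 0] stays within distance 1 of [phi], hence never meets the clipping. In particular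
    the set of initial values with a solution on the whole interval is open. *)
Lemma sol_near : exists r G, 0 < r /\ 1 <= G /\
  forall w, Cmod (Cminus w (phi 0)) < r ->
    exists z, sol n omega a b z /\ z 0 = w /\
      forall t, itv omega t -> Cmod (Cminus (z t) (phi t)) <= G * Cmod (Cminus w (phi 0)).
Proof.
  assert (hA : 0 <= A) by (eapply Rle_trans; [apply Rabs_pos | apply (a_bd 0)]).
  destruct (sol_bounded _ _ _ _ _ homega hphi) as [M [hM bM]].
  destruct (vf_lipschitz n A (2 * (M + 1))) as [K [hK k]]; [lra | lra |].
  destruct (gronwall_bound omega K homega (Rlt_le _ _ hK)) as [G [hG g]].
  exists (/ G), G. split; [apply Rinv_0_lt_compat; lra |]. split; [exact hG |].
  intros w hr.
  destruct (trunc_flow n omega A (M + 1) a b homega ltac:(lra) a_cont b_cont a_bd b_bd w)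
    as [z [z0 hz]].
  assert (hclose : forall t, itv omega t ->
            Cmod (Cminus (z t) (phi t)) <= G * Cmod (Cminus w (phi 0))).
  { intros t ht.
    rewrite <- z0, <- (Rplus_0_r (Cmod (Cminus (z 0) (phi 0)))).
    apply (g (fun s => Cminus (z s) (phi s))
      (fun s => Cminus (vf n (a s) (b s) (cclip (M + 1) (z s))) (vf n (a s) (b s) (phi s))));
      [lra | | | exact ht].
    - intros s hs. apply cderiv_minus; [now apply hz | now apply hphi].
    - intros s hs. rewrite Rplus_0_r.
      specialize (bM s hs).
      rewrite <- (cclip_id (M + 1) (phi s)) by lra.
      eapply Rle_trans; [apply k; auto; apply cclip_bound; lra |].
      apply Rmult_le_compat_l; [lra |].
      eapply Rle_trans; [apply cclip_lip; lra |]. rewrite (cclip_id (M + 1) (phi s)); lra. }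
  exists z. split; [| split; [exact z0 | exact hclose]].
  intros t ht.
  assert (hb : Cmod (z t) <= M + 1).
  { replace (z t) with ((z t - phi t) + phi t)%C by ring.
    eapply Rle_trans; [apply Cmod_triangle |].
    specialize (bM t ht). specialize (hclose t ht).
    apply (Rmult_lt_compat_l G) in hr; [| lra]. rewrite Rinv_r in hr; lra. }
  rewrite -(cclip_id (M + 1) (z t) hb). now apply hz.
Qed.
End Perturbation.

(* Taylor coefficients of x^k: pow_d2 is half of the second derivative. *)
Fixpoint pow_d1 (k : nat) (x : C) : C :=
  match k with O => RtoC 0 | S k => Cplus (Cmult x (pow_d1 k x)) (Cpow x k) end.

Fixpoint pow_d2 (k : nat) (x : C) : C :=
  match k with O => RtoC 0 | S k => Cplus (Cmult x (pow_d2 k x)) (pow_d1 k x) end.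

Lemma pow_d1_eq (k : nat) (x : C) : pow_d1 (S k) x = Cmult (RtoC (INR (S k))) (Cpow x k).
Proof.
  induction k as [|k IH].
  - simpl. ring.
  - change (pow_d1 (S (S k)) x) with (Cplus (Cmult x (pow_d1 (S k) x)) (Cpow x (S k))).
    rewrite IH (S_INR (S k)) RtoC_plus Cpow_S. ring.
Qed.

Lemma pow_d_bound (M : R) (k : nat) : 0 <= M -> exists K, 0 <= K /\
  forall x, Cmod x <= M -> Cmod (pow_d1 k x) <= K /\ Cmod (pow_d2 k x) <= K.
Proof.
  intros hM. induction k as [|k [K [hK IH]]].
  - exists 0. split; [lra |]. intros x _. simpl. rewrite Cmod_0. lra.
  - pose proof (pow_le M k hM). exists (M * K + M ^ k + K). split; [nra |].
    intros x hx. destruct (IH x hx) as [i1 i2].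
    pose proof (Cmod_pow_le M x k hx). pose proof (Cmod_ge_0 x).
    pose proof (Cmod_ge_0 (pow_d1 k x)). pose proof (Cmod_ge_0 (pow_d2 k x)).
    simpl. split; (eapply Rle_trans; [apply Cmod_triangle |]); rewrite Cmod_mult; nra.
Qed.

Lemma Cpow_taylor (M : R) (k : nat) : 0 <= M -> exists K, 0 <= K /\
  forall x d, Cmod x <= M -> Cmod d <= M ->
    Cmod (Cpow (x + d) k - Cpow x k - pow_d1 k x * d - pow_d2 k x * (d * d))%C
    <= K * Cmod d ^ 3.
Proof.
  intros hM. induction k as [|k [K [hK IH]]].
  - exists 0. split; [lra |]. intros x d _ _. simpl.
    match goal with |- Cmod ?e <= _ => replace e with (RtoC 0) by ring end.
    rewrite Cmod_0. lra.
  - destruct (pow_d_bound M k hM) as [P [hP p]].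
    exists (2 * M * K + P). split; [nra |].
    intros x d hx hd. specialize (IH x d hx hd). destruct (p x hx) as [_ p2].
    set (e := (Cpow (x + d) k - Cpow x k - pow_d1 k x * d - pow_d2 k x * (d * d))%C) in *.
    (* Multiplying the expansion of (x + d)^k by x + d shows that the remainder for k + 1 is (x + d)
       e plus the term of order d^3 coming from [pow_d2 k x]. *)
    match goal with |- Cmod ?y <= _ =>
      replace y with ((x + d) * e + pow_d2 k x * (d * (d * d)))%C
        by (unfold e; simpl; ring) end.
    eapply Rle_trans; [apply Cmod_triangle |]. rewrite !Cmod_mult.
    pose proof (Cmod_triangle x d). pose proof (Cmod_ge_0 (x + d)).
    pose proof (Cmod_ge_0 e). pose proof (Cmod_ge_0 d).
    assert (Cmod (x + d) * Cmod e <= 2 * M * (K * Cmod d ^ 3)).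
    { apply Rmult_le_compat; lra. }
    assert (0 <= Cmod d ^ 3) by (apply pow_le; lra).
    replace (Cmod d * (Cmod d * Cmod d)) with (Cmod d ^ 3) by ring.
    nra.
Qed.

Definition vf_d1 (n : nat) (a b : R) (z : C) : C :=
  Cplus (Cplus (pow_d1 n z) (Cmult (RtoC a) (pow_d1 (n - 1) z)))
        (Cmult (RtoC b) (pow_d1 (n - 2) z)).

Definition vf_d2 (n : nat) (a b : R) (z : C) : C :=
  Cplus (Cplus (pow_d2 n z) (Cmult (RtoC a) (pow_d2 (n - 1) z)))
        (Cmult (RtoC b) (pow_d2 (n - 2) z)).

Lemma vf_taylor (n : nat) (A M : R) : 0 <= A -> 0 <= M ->
  exists K, 0 <= K /\ forall a b x d, Rabs a <= A -> Rabs b <= A ->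
    Cmod x <= M -> Cmod d <= M ->
    Cmod (vf n a b (x + d) - vf n a b x - vf_d1 n a b x * d - vf_d2 n a b x * (d * d))%C
    <= K * Cmod d ^ 3.
Proof.
  intros hA hM.
  destruct (Cpow_taylor M n hM) as [K1 [h1 k1]].
  destruct (Cpow_taylor M (n - 1) hM) as [K2 [h2 k2]].
  destruct (Cpow_taylor M (n - 2) hM) as [K3 [h3 k3]].
  exists (K1 + A * K2 + A * K3). split; [nra |].
  intros a b x d ha hb hx hd. unfold vf, vf_d1, vf_d2.
  specialize (k1 x d hx hd); specialize (k2 x d hx hd); specialize (k3 x d hx hd).
  match type of k1 with Cmod ?e <= _ => set (e1 := e) in * end.
  match type of k2 with Cmod ?e <= _ => set (e2 := e) in * end.
  match type of k3 with Cmod ?e <= _ => set (e3 := e) in * end.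
  match goal with |- Cmod ?e <= _ => replace e with (e1 + RtoC a * e2 + RtoC b * e3)%C
    by (unfold e1, e2, e3; ring) end.
  eapply Rle_trans; [apply Cmod_triangle |].
  eapply Rle_trans; [apply Rplus_le_compat_r, Cmod_triangle |].
  rewrite !Cmod_mult !Cmod_R.
  pose proof (Rmult_le_compat _ _ _ _ (Rabs_pos a) (Cmod_ge_0 _) ha k2).
  pose proof (Rmult_le_compat _ _ _ _ (Rabs_pos b) (Cmod_ge_0 _) hb k3).
  lra.
Qed.

Lemma vf_d_bound (n : nat) (A M : R) : 0 <= A -> 0 <= M ->
  exists K, 0 <= K /\ forall a b x, Rabs a <= A -> Rabs b <= A -> Cmod x <= M ->
    Cmod (vf_d1 n a b x) <= K /\ Cmod (vf_d2 n a b x) <= K.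
Proof.
  intros hA hM.
  destruct (pow_d_bound M n hM) as [K1 [h1 k1]].
  destruct (pow_d_bound M (n - 1) hM) as [K2 [h2 k2]].
  destruct (pow_d_bound M (n - 2) hM) as [K3 [h3 k3]].
  exists (K1 + A * K2 + A * K3). split; [nra |].
  intros a b x ha hb hx.
  destruct (k1 x hx) as [p1 q1], (k2 x hx) as [p2 q2], (k3 x hx) as [p3 q3].
  unfold vf_d1, vf_d2.
  split; (eapply Rle_trans; [apply Cmod_triangle |];
    eapply Rle_trans; [apply Rplus_le_compat_r, Cmod_triangle |]); rewrite !Cmod_mult !Cmod_R.
  - pose proof (Rmult_le_compat _ _ _ _ (Rabs_pos a) (Cmod_ge_0 _) ha p2).
    pose proof (Rmult_le_compat _ _ _ _ (Rabs_pos b) (Cmod_ge_0 _) hb p3). lra.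
  - pose proof (Rmult_le_compat _ _ _ _ (Rabs_pos a) (Cmod_ge_0 _) ha q2).
    pose proof (Rmult_le_compat _ _ _ _ (Rabs_pos b) (Cmod_ge_0 _) hb q3). lra.
Qed.

Lemma ccont_pow_d1 (k : nat) (z : R -> C) (t : R) :
  ccont z t -> ccont (fun s => pow_d1 k (z s)) t.
Proof.
  intros H. induction k as [|k I]; [apply (ccont_const (RtoC 0)) |].
  apply (ccont_plus (fun s => Cmult (z s) (pow_d1 k (z s))) (fun s => Cpow (z s) k));
    [now apply (ccont_mult z (fun s => pow_d1 k (z s))) | now apply ccont_pow].
Qed.

Lemma ccont_pow_d2 (k : nat) (z : R -> C) (t : R) :
  ccont z t -> ccont (fun s => pow_d2 k (z s)) t.
Proof.
  intros H. induction k as [|k I]; [apply (ccont_const (RtoC 0)) |].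
  apply (ccont_plus (fun s => Cmult (z s) (pow_d2 k (z s))) (fun s => pow_d1 k (z s)));
    [now apply (ccont_mult z (fun s => pow_d2 k (z s))) | now apply ccont_pow_d1].
Qed.

Lemma ccont_vf_d1 (n : nat) (a b : R -> R) (z : R -> C) (t : R) :
  continuous a t -> continuous b t -> ccont z t ->
  ccont (fun s => vf_d1 n (a s) (b s) (z s)) t.
Proof.
  intros ha hb hz. pose proof (fun k => ccont_pow_d1 k z t hz) as hk.
  pose proof (ccont_real _ _ ha) as ha'. pose proof (ccont_real _ _ hb) as hb'.
  exact (ccont_plus _ _ t (ccont_plus _ _ t (hk n) (ccont_mult _ _ t ha' (hk (n - 1)%nat)))
          (ccont_mult _ _ t hb' (hk (n - 2)%nat))).
Qed.

Lemma ccont_vf_d2 (n : nat) (a b : R -> R) (z : R -> C) (t : R) :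
  continuous a t -> continuous b t -> ccont z t ->
  ccont (fun s => vf_d2 n (a s) (b s) (z s)) t.
Proof.
  intros ha hb hz. pose proof (fun k => ccont_pow_d2 k z t hz) as hk.
  pose proof (ccont_real _ _ ha) as ha'. pose proof (ccont_real _ _ hb) as hb'.
  exact (ccont_plus _ _ t (ccont_plus _ _ t (hk n) (ccont_mult _ _ t ha' (hk (n - 1)%nat)))
          (ccont_mult _ _ t hb' (hk (n - 2)%nat))).
Qed.

(** * Second-order expansion of the flow *)

Section Expansion.
Variables (n : nat) (omega A : R) (a b : R -> R) (phi : R -> C).
Hypothesis homega : 0 < omega.
Hypothesis a_cont : forall t, continuous a t.
Hypothesis b_cont : forall t, continuous b t.
Hypothesis a_bd : forall t, Rabs (a t) <= A.
Hypothesis b_bd : forall t, Rabs (b t) <= A.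
Hypothesis hphi : sol n omega a b phi.

(** [D] solves the variational equation D' = p D, and the second-order coefficient solves E' = p E +
    p2 D^2 with E(0) = 0. With h the change of initial value and d the difference of the solutions,
    d - h D and then d - h D - h^2 E satisfy the same linear equation up to source terms of order 2
    and 3, so Gronwall applies to each. *)
Lemma sol_expand : exists D : R -> C,
  D 0 = RtoC 1 /\
  (forall t, itv omega t -> cderiv D t (Cmult (vf_d1 n (a t) (b t) (phi t)) (D t))) /\
  exists (D2 : C) (K r : R), 0 <= K /\ 0 < r /\
    forall w, Cmod (Cminus w (phi 0)) < r ->
      exists z, sol n omega a b z /\ z 0 = w /\
        Cmod (z omega - phi omega - (w - phi 0) * D omega
              - (w - phi 0) * (w - phi 0) * D2)%C <= K * Cmod (Cminus w (phi 0)) ^ 3.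
Proof.
  assert (hA : 0 <= A) by (eapply Rle_trans; [apply Rabs_pos | apply (a_bd 0)]).
  destruct (sol_bounded _ _ _ _ _ homega hphi) as [M [hM bM]].
  destruct (sol_near n omega A a b phi homega a_cont b_cont a_bd b_bd hphi)
    as [r0 [G [hr0 [hG near]]]].
  destruct (vf_d_bound n A M hA hM) as [P [hP bP]].
  destruct (vf_taylor n A (M + 1) hA) as [T [hT bT]]; [lra |].
  destruct (gronwall_bound omega P homega hP) as [G2 [hG2 g]].
  (* [linear_flow] asks for coefficients continuous on the whole line, whereas [phi] is controlled
     only on the interval; hence the clamp. *)
  set (p := fun s => vf_d1 n (a s) (b s) (phi (clamp omega s))).
  set (p2 := fun s => vf_d2 n (a s) (b s) (phi (clamp omega s))).
  assert (phic : forall s, ccont (fun s => phi (clamp omega s)) s).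
  { intros s. apply (ccont_comp phi); [now apply clamp_continuous |].
    eapply cderiv_ccont. apply hphi. now apply clamp_itv. }
  assert (hp : forall s, ccont p s) by
    (intros s; exact (ccont_vf_d1 n a b _ s (a_cont s) (b_cont s) (phic s))).
  assert (hp2 : forall s, ccont p2 s) by
    (intros s; exact (ccont_vf_d2 n a b _ s (a_cont s) (b_cont s) (phic s))).
  assert (pb : forall s, Cmod (p s) <= P /\ Cmod (p2 s) <= P).
  { intros s. apply bP; auto. apply bM. now apply clamp_itv. }
  destruct (linear_flow omega P p (fun _ => RtoC 0) (RtoC 1) homega hp) as [D [D0 hD]];
    [intros; apply ccont_const | apply pb |].
  assert (hD' : forall t, itv omega t -> cderiv D t (Cmult (p t) (D t))).
  { intros t ht. eapply cderiv_eq; [now apply hD | ring]. }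
  assert (Dc : forall s, ccont (fun s => D (clamp omega s)) s).
  { intros s. apply (ccont_comp D); [now apply clamp_continuous |].
    eapply cderiv_ccont. apply hD. now apply clamp_itv. }
  destruct (linear_flow omega P p
    (fun s => Cmult (p2 s) (Cmult (D (clamp omega s)) (D (clamp omega s)))) (RtoC 0) homega hp)
    as [E [E0 hE]]; [| apply pb |].
  { intros t. apply ccont_mult; [apply hp2 | now apply ccont_mult]. }
  destruct (ccont_bounded_itv omega D homega) as [Q [hQ bQ]].
  { intros t ht. eapply cderiv_ccont. now apply hD. }
  exists D. split; [exact D0 |]. split.
  { intros t ht. eapply cderiv_eq; [now apply hD' |].
    unfold p. now rewrite (clamp_id omega t ht). }
  set (C1 := G2 * ((P + T) * G ^ 2)).
  assert (hC1 : 0 <= C1).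
  { unfold C1. apply Rmult_le_pos; [lra |]. apply Rmult_le_pos; [lra |]. apply pow_le; lra. }
  assert (hG3 : 0 <= G ^ 3) by (apply pow_le; lra).
  set (C2 := P * (C1 * (G + Q)) + T * G ^ 3).
  assert (hC2 : 0 <= C2).
  { unfold C2. assert (0 <= C1 * (G + Q)) by (apply Rmult_le_pos; lra). nra. }
  (* The radius 1 / G gives |d| <= 1: this keeps d within the range of the Taylor bound and lets the
     cubic remainder be absorbed by squares in the first estimate. *)
  exists (E omega), (G2 * C2), (Rmin r0 (/ G)).
  split; [apply Rmult_le_pos; lra |].
  split; [apply Rmin_pos; [exact hr0 | apply Rinv_0_lt_compat; lra] |].
  intros w hw. set (h := Cminus w (phi 0)) in *.
  destruct (near w) as [z [hz [z0 hclose]]].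
  { eapply Rlt_le_trans; [exact hw | apply Rmin_l]. }
  fold h in hclose.
  exists z. split; [exact hz |]. split; [exact z0 |].
  assert (hGh : G * Cmod h <= 1).
  { assert (Cmod h < / G) by (eapply Rlt_le_trans; [exact hw | apply Rmin_r]).
    apply (Rmult_lt_compat_l G) in H; [| lra]. rewrite Rinv_r in H; lra. }
  pose proof (Cmod_ge_0 h) as hh0.
  set (x := Cmod h) in *.
  set (d := fun t => Cminus (z t) (phi t)).
  set (S3 := fun t => (vf n (a t) (b t) (z t) - vf n (a t) (b t) (phi t)
                       - p t * d t - p2 t * (d t * d t))%C).
  assert (bS : forall t, itv omega t -> Cmod (S3 t) <= T * Cmod (d t) ^ 3).
  { intros t ht. unfold S3, p, p2. rewrite (clamp_id omega t ht).
    replace (z t) with (phi t + d t)%C by (unfold d; ring).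
    specialize (hclose t ht). specialize (bM t ht). fold (d t) in hclose.
    apply bT; auto; lra. }
  assert (d0 : d 0 = h) by (unfold d; now rewrite z0).
  assert (dd : forall t, itv omega t ->
    cderiv d t (Cminus (vf n (a t) (b t) (z t)) (vf n (a t) (b t) (phi t)))).
  { intros t ht. apply cderiv_minus; [now apply hz | now apply hphi]. }
  assert (bd : forall t, itv omega t -> Cmod (d t) <= G * x /\
                 Cmod (d t) ^ 2 <= G ^ 2 * x ^ 2 /\ Cmod (d t) ^ 3 <= G ^ 3 * x ^ 3).
  { intros t ht. specialize (hclose t ht). fold (d t) in hclose.
    split; [exact hclose |].
    split; (eapply Rle_trans; [apply pow_incr; split; [apply Cmod_ge_0 | exact hclose] |];
      right; ring). }
  (* First-order remainder: it starts at 0 and its source p2 d^2 + S3 is quadratic in |h|. *)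
  set (u1 := fun t => Cminus (d t) (Cmult h (D t))).
  assert (cD : forall t, itv omega t -> cderiv (fun s => Cmult h (D s)) t (h * (p t * D t))%C).
  { intros t ht. eapply cderiv_eq.
    - apply cderiv_mult; [apply cderiv_const | now apply hD'].
    - cbv beta. ring. }
  assert (b1 : forall t, itv omega t -> Cmod (u1 t) <= C1 * x ^ 2).
  { intros t ht.
    replace (C1 * x ^ 2) with (G2 * (Cmod (u1 0) + (P + T) * G ^ 2 * x ^ 2)).
    2: { unfold u1. rewrite d0 D0. replace (h - h * 1)%C with (RtoC 0) by ring.
         rewrite Cmod_0. unfold C1. ring. }
    apply (g u1 (fun t => p t * u1 t + (p2 t * (d t * d t) + S3 t))%C); [| | | exact ht].
    - apply Rmult_le_pos; [apply Rmult_le_pos; [lra | apply pow_le; lra] | apply pow2_ge_0].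
    - intros s hs. eapply cderiv_eq; [apply cderiv_minus; [now apply dd | now apply cD] |].
      unfold S3, u1. ring.
    - intros s hs. eapply Rle_trans; [apply Cmod_triangle |].
      rewrite Cmod_mult. destruct (pb s) as [k1 k2].
      destruct (bd s hs) as [e1 [e2 e3]].
      apply Rplus_le_compat.
      { apply Rmult_le_compat_r; [apply Cmod_ge_0 | exact k1]. }
      eapply Rle_trans; [apply Cmod_triangle |]. rewrite !Cmod_mult.
      specialize (bS s hs). pose proof (Cmod_ge_0 (d s)) as hd0.
      assert (Cmod (d s) ^ 3 <= Cmod (d s) ^ 2).
      { replace (Cmod (d s) ^ 3) with (Cmod (d s) * Cmod (d s) ^ 2) by ring.
        pose proof (pow2_ge_0 (Cmod (d s))). nra. }
      replace (Cmod (d s) * Cmod (d s)) with (Cmod (d s) ^ 2) by ring.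
      pose proof (pow2_ge_0 (Cmod (d s))).
      assert (Cmod (p2 s) * Cmod (d s) ^ 2 <= P * (G ^ 2 * x ^ 2)).
      { apply Rmult_le_compat; auto using Cmod_ge_0. }
      assert (T * Cmod (d s) ^ 3 <= T * (G ^ 2 * x ^ 2)).
      { apply Rmult_le_compat_l; lra. }
      nra. }
  (* Second-order remainder: its source contains d^2 - (h D)^2 = u1 (d + h D), which is cubic thanks
     to the bound just obtained for [u1]. *)
  set (u2 := fun t => Cminus (u1 t) (Cmult (Cmult h h) (E t))).
  assert (b2 : forall t, itv omega t -> Cmod (u2 t) <= G2 * C2 * x ^ 3).
  { intros t ht.
    replace (G2 * C2 * x ^ 3) with (G2 * (Cmod (u2 0) + C2 * x ^ 3)).
    2: { unfold u2, u1. rewrite d0 D0 E0.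
         replace (h - h * 1 - h * h * 0)%C with (RtoC 0) by ring.
         rewrite Cmod_0. ring. }
    apply (g u2 (fun t => p t * u2 t + (p2 t * (u1 t * (d t + h * D t)) + S3 t))%C);
      [| | | exact ht].
    - apply Rmult_le_pos; [lra | apply pow_le; lra].
    - intros s hs. eapply cderiv_eq.
      { apply cderiv_minus; [apply cderiv_minus; [now apply dd | now apply cD] |].
        apply cderiv_mult; [apply cderiv_const | now apply hE]. }
      rewrite (clamp_id omega s hs). unfold S3, u2, u1. ring.
    - intros s hs. eapply Rle_trans; [apply Cmod_triangle |].
      rewrite Cmod_mult. destruct (pb s) as [k1 k2].
      destruct (bd s hs) as [e1 [e2 e3]].
      apply Rplus_le_compat.
      { apply Rmult_le_compat_r; [apply Cmod_ge_0 | exact k1]. }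
      eapply Rle_trans; [apply Cmod_triangle |]. rewrite !Cmod_mult.
      specialize (bS s hs). specialize (b1 s hs).
      assert (k3 : Cmod (d s + h * D s) <= (G + Q) * x).
      { eapply Rle_trans; [apply Cmod_triangle |]. rewrite Cmod_mult. fold x.
        specialize (bQ s hs). nra. }
      assert (Cmod (u1 s) * Cmod (d s + h * D s) <= C1 * x ^ 2 * ((G + Q) * x)).
      { apply Rmult_le_compat; auto using Cmod_ge_0. }
      assert (Cmod (p2 s) * (Cmod (u1 s) * Cmod (d s + h * D s))
              <= P * (C1 * x ^ 2 * ((G + Q) * x))).
      { apply Rmult_le_compat; auto using Cmod_ge_0, Rmult_le_pos. }
      assert (T * Cmod (d s) ^ 3 <= T * (G ^ 3 * x ^ 3)).
      { apply Rmult_le_compat_l; lra. }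
      unfold C2. nra. }
  specialize (b2 omega ltac:(split; lra)).
  unfold u2, u1, d in b2. exact b2.
Qed.
End Expansion.

(** * Simple zeros of the displacement *)

(** The balls of [C_UniformSpace] are squares; the one with half-side r / 2 lies in the disc of
    radius r. *)
Lemma locally_Cmod (c : C) (r : R) (P : C -> Prop) :
  0 < r -> (forall w, Cmod (Cminus w c) < r -> P w) -> locally (T := C_UniformSpace) c P.
Proof.
  intros hr H. assert (h2 : 0 < r / 2) by lra.
  exists (mkposreal _ h2). intros w [h3 h4]. apply H.
  change (Rabs (Re w - Re c) < r / 2) in h3. change (Rabs (Im w - Im c) < r / 2) in h4.
  eapply Rle_lt_trans; [apply Cmod_le_Re_Im |].
  change (Rabs (Re w - Re c) + Rabs (Im w - Im c) < r). lra.
Qed.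

Lemma C_derive_of_quadratic (g : C -> C) (w0 m : C) (K r : R) :
  0 <= K -> 0 < r ->
  (forall w, Cmod (Cminus w w0) < r ->
     Cmod (g w - g w0 - (w - w0) * m)%C <= K * Cmod (Cminus w w0) ^ 2) ->
  ex_derive (K := C_AbsRing) (V := C_NormedModule) g w0.
Proof.
  intros hK hr H. exists m.
  split; [apply (@is_linear_scal_l C_AbsRing C_NormedModule) |].
  intros x hx.
  assert (e : w0 = x).
  { apply (@is_filter_lim_locally_unique C_AbsRing (AbsRing_NormedModule C_AbsRing)). exact hx. }
  subst x. intros eps.
  assert (hd : 0 < Rmin r (eps / (K + 1))).
  { apply Rmin_pos; [exact hr | apply Rdiv_lt_0_compat; [apply eps | lra]]. }
  exists (mkposreal _ hd). intros w hw.
  change (Cmod (Cminus w w0) < Rmin r (eps / (K + 1))) in hw.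
  change (Cmod (g w - g w0 - (w - w0) * m)%C <= eps * Cmod (Cminus w w0)).
  assert (h1 : Cmod (Cminus w w0) < r) by (eapply Rlt_le_trans; [exact hw | apply Rmin_l]).
  assert (h2 : Cmod (Cminus w w0) < eps / (K + 1))
    by (eapply Rlt_le_trans; [exact hw | apply Rmin_r]).
  apply Rlt_div_r in h2; [| lra].
  eapply Rle_trans; [apply (H w h1) |].
  pose proof (Cmod_ge_0 (Cminus w w0)). nra.
Qed.

Section Multiplicity.
Variables (n : nat) (omega : R) (alpha beta : R -> R).
Hypothesis homega : 0 < omega.
Hypothesis halpha : cont_itv omega alpha.
Hypothesis hbeta : cont_itv omega beta.

(** Flows are constructed for coefficients continuous and bounded on the whole line, while a
    solution only sees their values on the interval. *)
Lemma coefficients_extend : exists (a b : R -> R) (A : R),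
  (forall t, continuous a t) /\ (forall t, continuous b t) /\
  (forall t, Rabs (a t) <= A) /\ (forall t, Rabs (b t) <= A) /\
  (forall t, itv omega t -> a t = alpha t) /\ (forall t, itv omega t -> b t = beta t).
Proof.
  pose proof (cont_itv_clamp omega alpha homega halpha) as ca.
  pose proof (cont_itv_clamp omega beta homega hbeta) as cb.
  destruct (continuous_bounded_itv omega _ homega (fun t _ => ca t)) as [A1 [h1 k1]].
  destruct (continuous_bounded_itv omega _ homega (fun t _ => cb t)) as [A2 [h2 k2]].
  exists (fun t => alpha (clamp omega t)), (fun t => beta (clamp omega t)), (A1 + A2).
  assert (cc : forall t, clamp omega (clamp omega t) = clamp omega t).
  { intros t. apply clamp_id. now apply clamp_itv. }
  repeat split; auto.
  - intros t. specialize (k1 _ (clamp_itv omega homega t)). rewrite cc in k1. lra.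
  - intros t. specialize (k2 _ (clamp_itv omega homega t)). rewrite cc in k2. lra.
  - intros t ht. now rewrite (clamp_id omega t ht).
  - intros t ht. now rewrite (clamp_id omega t ht).
Qed.

Lemma sol_coefficients (a b : R -> R) (z : R -> C) :
  (forall t, itv omega t -> a t = alpha t) -> (forall t, itv omega t -> b t = beta t) ->
  sol n omega a b z <-> sol n omega alpha beta z.
Proof.
  intros ha hb; split; intros H t ht; specialize (H t ht).
  - now rewrite <- (ha t ht), <- (hb t ht).
  - now rewrite (ha t ht) (hb t ht).
Qed.

Lemma sol_unique_cont (z w : R -> C) (t0 : R) :
  sol n omega alpha beta z -> sol n omega alpha beta w ->
  itv omega t0 -> z t0 = w t0 -> forall t, itv omega t -> z t = w t.
Proof.
  intros hz hw.
  destruct coefficients_extend as [a [b [A [ca [cb [ba [bb [ea eb]]]]]]]].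
  apply (sol_unique n omega A a b z w t0 homega).
  - eapply Rle_trans; [apply Rabs_pos | apply (ba 0)].
  - intros t _; apply ba.
  - intros t _; apply bb.
  - now apply (sol_coefficients a b z ea eb).
  - now apply (sol_coefficients a b w ea eb).
Qed.

(** [flow] picks some one-sided solution by choice. Uniqueness, applied to its tangent extension,
    identifies the choice with any known solution. *)
Lemma flow_eq (z : R -> C) (t : R) :
  sol n omega alpha beta z -> itv omega t -> flow n omega alpha beta t (z 0) = z t.
Proof.
  intros hz ht. unfold flow.
  assert (hex : exists u, solution_from n omega alpha beta (z 0) u).
  { exists z. split; [now apply sol_is_solution | reflexivity]. }
  pose proof (epsilon_spec (inhabits (fun _ : R => RtoC 0)) _ hex) as [h1 h2].
  set (u := epsilon _ _) in *.
  destruct (is_solution_extend n omega alpha beta u homega h1) as [U [e hU]].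
  rewrite <- (e t ht).
  assert (h0 : itv omega 0) by (unfold itv; lra).
  apply (sol_unique_cont U z 0); auto. now rewrite (e 0 h0).
Qed.

Lemma flow_expand (phi : R -> C) : sol n omega alpha beta phi ->
  exists D : R -> C, D 0 = RtoC 1 /\
  (forall t, itv omega t -> cderiv D t (Cmult (vf_d1 n (alpha t) (beta t) (phi t)) (D t))) /\
  exists (D2 : C) (K r : R), 0 <= K /\ 0 < r /\
    forall w, Cmod (Cminus w (phi 0)) < r ->
      Cmod (flow n omega alpha beta omega w - phi omega - (w - phi 0) * D omega
              - (w - phi 0) * (w - phi 0) * D2)%C <= K * Cmod (Cminus w (phi 0)) ^ 3.
Proof.
  intros hphi.
  destruct coefficients_extend as [a [b [A [ca [cb [ba [bb [ea eb]]]]]]]].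
  destruct (sol_expand n omega A a b phi homega ca cb ba bb) as [D [D0 [hD [D2 [K [r [hK [hr H]]]]]]]].
  { now apply (sol_coefficients a b phi ea eb). }
  exists D. split; [exact D0 |]. split.
  { intros t ht. rewrite <- (ea t ht), <- (eb t ht). now apply hD. }
  exists D2, K, r. split; [exact hK |]. split; [exact hr |].
  intros w hw. destruct (H w hw) as [z [hz [z0 he]]].
  rewrite <- z0 at 1. rewrite (flow_eq z omega); [exact he | | unfold itv; lra].
  now apply (sol_coefficients a b z ea eb).
Qed.

Lemma sol_nearby (phi : R -> C) : sol n omega alpha beta phi ->
  exists r, 0 < r /\ forall w, Cmod (Cminus w (phi 0)) < r ->
    exists z, sol n omega alpha beta z /\ z 0 = w.
Proof.
  intros hphi.
  destruct coefficients_extend as [a [b [A [ca [cb [ba [bb [ea eb]]]]]]]].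
  destruct (sol_near n omega A a b phi homega ca cb ba bb) as [r [G [hr [_ H]]]].
  { now apply (sol_coefficients a b phi ea eb). }
  exists r. split; [exact hr |]. intros w hw. destruct (H w hw) as [z [hz [z0 _]]].
  exists z. split; [| exact z0]. now apply (sol_coefficients a b z ea eb).
Qed.

(* The second-order expansion of the flow makes the difference quotient
   q(w) / (w - c) differentiable at w = c as well. *)
Lemma simple_zero (phi : R -> C) :
  sol n omega alpha beta phi -> phi omega = phi 0 ->
  (forall D : R -> C, D 0 = RtoC 1 ->
     (forall t, itv omega t -> cderiv D t (Cmult (vf_d1 n (alpha t) (beta t) (phi t)) (D t))) ->
     D omega <> RtoC 1) ->
  zero_multiplicity (displacement n omega alpha beta) (phi 0) 1.
Proof.
  intros hphi hper hne. set (c := phi 0).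
  destruct (flow_expand phi hphi) as [D [D0 [hD [D2 [K [r [hK [hr H]]]]]]]].
  set (q := displacement n omega alpha beta).
  assert (qc : q c = RtoC 0).
  { unfold q, displacement. rewrite (flow_eq phi omega hphi); [| unfold itv; lra].
    rewrite hper. unfold c. ring. }
  (* At [c] the quotient is completed by q'(c) = [D omega] - 1, which is non-zero by [hne]. *)
  set (g := fun w => match excluded_middle_informative (w = c) with
                     | left _ => Cminus (D omega) 1
                     | right _ => Cdiv (q w) (Cminus w c) end).
  assert (gc : g c = Cminus (D omega) 1).
  { unfold g. destruct excluded_middle_informative; congruence. }
  assert (gw : forall w, q w = Cmult (Cminus w c) (g w)).
  { intros w. destruct (excluded_middle_informative (w = c)) as [e | e].
    - rewrite e qc. ring.
    - unfold g. destruct excluded_middle_informative; [contradiction |].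
      field. intros h. apply e.
      replace w with ((w - c) + c)%C by ring. rewrite h. ring. }
  assert (sub_ne : forall w, w <> c -> Cminus w c <> RtoC 0).
  { intros w hw h. apply hw. replace w with ((w - c) + c)%C by ring. rewrite h. ring. }
  exists g. split; [| split].
  - destruct (sol_nearby phi hphi) as [r1 [hr1 near]].
    apply (locally_Cmod c r1); [exact hr1 |]. intros w0 hw0.
    destruct (excluded_middle_informative (w0 = c)) as [e | e].
    (* Dividing the expansion at [c] by w - c leaves g(w) = g(c) + (w - c) D2 up to a quadratic
       error, so g'(c) = [D2]. *)
    + rewrite e. apply (C_derive_of_quadratic g c D2 K r hK hr).
      intros w hw. specialize (H w hw). fold c in H.
      destruct (excluded_middle_informative (w = c)) as [e' | e'].
      { rewrite e'. replace (g c - g c - (c - c) * D2)%C with (RtoC 0) by ring.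
        replace (c - c)%C with (RtoC 0) by ring. rewrite Cmod_0. nra. }
      pose proof (sub_ne w e') as hne'.
      assert (hp : 0 < Cmod (w - c)) by (now apply Cmod_gt_0).
      apply Rmult_le_reg_l with (Cmod (w - c)); [exact hp |].
      rewrite <- Cmod_mult.
      replace ((w - c) * (g w - g c - (w - c) * D2))%C
        with (flow n omega alpha beta omega w - phi omega - (w - c) * D omega
              - (w - c) * (w - c) * D2)%C.
      * eapply Rle_trans; [exact H |]. right. ring.
      * replace ((w - c) * (g w - g c - (w - c) * D2))%C
          with ((w - c) * g w - (w - c) * g c - (w - c) * (w - c) * D2)%C by ring.
        rewrite <- gw, gc, hper. unfold q, displacement. fold c. ring.
    + destruct (near w0 hw0) as [z [hz z0]].
      destruct (flow_expand z hz) as [E [E0 [_ [E2 [K' [r' [hK' [hr' H']]]]]]]].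
      rewrite z0 in H'.
      pose proof (sub_ne w0 e) as hne'.
      assert (hp : 0 < Cmod (w0 - c)) by (now apply Cmod_gt_0).
      set (p := Cmod (w0 - c)) in *.
      (* Quotient rule for q / (w - c) at [w0], with q'(w0) = [E omega] - 1. *)
      set (m := ((E omega - 1 - g w0) / (w0 - c))%C).
      (* Radius 1 absorbs the cubic remainder into a square; radius p / 2 keeps |w - c| >= p / 2,
         whence the factor 2 / p in [K2]. *)
      set (r2 := Rmin (Rmin r' 1) (p / 2)).
      set (K2 := (K' + Cmod E2 + Cmod m) * (2 / p)).
      assert (hK2 : 0 <= K2).
      { unfold K2. pose proof (Cmod_ge_0 E2). pose proof (Cmod_ge_0 m).
        apply Rmult_le_pos; [lra |]. left. apply Rdiv_lt_0_compat; lra. }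
      apply (C_derive_of_quadratic g w0 m K2 r2 hK2).
      { unfold r2. repeat apply Rmin_pos; lra. }
      intros w hw.
      assert (h1 : Cmod (w - w0) < r').
      { eapply Rlt_le_trans; [exact hw |]. unfold r2.
        eapply Rle_trans; [apply Rmin_l | apply Rmin_l]. }
      assert (h2 : Cmod (w - w0) < 1).
      { eapply Rlt_le_trans; [exact hw |]. unfold r2.
        eapply Rle_trans; [apply Rmin_l | apply Rmin_r]. }
      assert (h3 : Cmod (w - w0) < p / 2).
      { eapply Rlt_le_trans; [exact hw |]. unfold r2. apply Rmin_r. }
      assert (h4 : p / 2 <= Cmod (w - c)).
      { assert (p <= Cmod (w - c) + Cmod (w - w0)); [| lra].
        unfold p. replace (w0 - c)%C with ((w - c) - (w - w0))%C by ring.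
        apply Cmod_minus_le. }
      specialize (H' w h1). set (h := Cminus w w0) in *. set (x := Cmod h) in *.
      match type of H' with Cmod ?y <= _ => set (er := y) in * end.
      assert (hx : 0 <= x) by apply Cmod_ge_0.
      assert (key : ((w - c) * (g w - g w0 - h * m))%C = (er + h * h * E2 - h * h * m)%C).
      { assert (q0 : ((w0 - c) * g w0)%C = (z omega - w0)%C).
        { rewrite <- gw. unfold q, displacement. rewrite <- z0.
          rewrite (flow_eq z omega hz); [reflexivity | unfold itv; lra]. }
        assert (qm : ((w0 - c) * m)%C = (E omega - 1 - g w0)%C).
        { unfold m. field. exact hne'. }
        replace ((w - c) * (g w - g w0 - h * m))%C
          with ((w - c) * g w - (w0 - c) * g w0 - h * g w0 - h * ((w0 - c) * m) - h * h * m)%C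
          by (unfold h; ring).
        rewrite <- gw, q0, qm. unfold er, q, displacement, h. ring. }
      apply Rmult_le_reg_l with (Cmod (w - c)); [lra |].
      rewrite <- Cmod_mult, key.
      assert (b1 : Cmod (er + h * h * E2 - h * h * m)%C
                   <= (K' + Cmod E2 + Cmod m) * x ^ 2).
      { eapply Rle_trans; [apply Cmod_minus_le |].
        eapply Rle_trans; [apply Rplus_le_compat_r, Cmod_triangle |].
        rewrite !Cmod_mult. fold x.
        assert (x ^ 3 <= x ^ 2).
        { replace (x ^ 3) with (x * x ^ 2) by ring. pose proof (pow2_ge_0 x). nra. }
        assert (K' * x ^ 3 <= K' * x ^ 2) by (apply Rmult_le_compat_l; lra).
        lra. }
      eapply Rle_trans; [exact b1 |].
      unfold K2.
      set (k := K' + Cmod E2 + Cmod m) in *.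
      replace (k * x ^ 2) with (p / 2 * (k * (2 / p) * x ^ 2)) by (field; lra).
      apply Rmult_le_compat_r; [| exact h4].
      apply Rmult_le_pos; [exact hK2 | apply pow2_ge_0].
  - rewrite gc. intros h. apply (hne D D0 hD).
    replace (D omega) with ((D omega - 1) + 1)%C by ring. rewrite h. ring.
  - apply (locally_Cmod c 1); [lra |]. intros w _. fold q. rewrite gw. simpl. ring.
Qed.
End Multiplicity.

(** * Periodic solutions are real and unique in sign *)

Lemma sign_constant (omega : R) (f : R -> R) :
  (forall t, itv omega t -> continuous f t) -> (forall t, itv omega t -> f t <> 0) ->
  (forall t, itv omega t -> 0 < f t) \/ (forall t, itv omega t -> f t < 0).
Proof.
  intros hc hn.
  assert (key : forall s t, itv omega s -> itv omega t -> f s < 0 -> 0 < f t -> False).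
  { intros s t hs ht h1 h2. unfold itv in *.
    destruct (Rtotal_order s t) as [h | [h | h]].
    - destruct (Ranalysis5.IVT_interv f s t) as [x [hx e]]; try assumption.
      + intros x hx. apply continuity_pt_filterlim, hc. lra.
      + apply (hn x); [lra | exact e].
    - subst. lra.
    - destruct (Ranalysis5.IVT_interv (fun x => - f x) t s) as [x [hx e]]; try lra.
      + intros x hx. apply continuity_pt_opp, continuity_pt_filterlim, hc. lra.
      + apply (hn x); lra. }
  destruct (classic (exists s, itv omega s /\ f s < 0)) as [[s [hs h]] | hno].
  - right. intros t ht. destruct (Rtotal_order (f t) 0) as [h' | [h' | h']]; auto.
    + now elim (hn t ht).
    + now elim (key s t).
  - left. intros t ht. destruct (Rtotal_order (f t) 0) as [h' | [h' | h']]; auto.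
    + elim hno. now exists t.
    + now elim (hn t ht).
Qed.

(** Writing n = k + 3 removes the truncated subtractions of exponents. The power of z shows that 0
    is a rest point, and the quadratic factor carries the coefficients. *)
Lemma vf_factor (k : nat) (a b : R) (z : C) :
  vf (k + 3) a b z = Cmult (Cpow z (k + 1)) (Cplus (Cplus (Cmult z z) (Cmult (RtoC a) z)) (RtoC b)).
Proof.
  unfold vf.
  replace (k + 3 - 1)%nat with (S (S k)) by lia. replace (k + 3 - 2)%nat with (S k) by lia.
  replace (k + 3)%nat with (S (S (S k))) by lia. replace (k + 1)%nat with (S k) by lia.
  rewrite !Cpow_S. ring.
Qed.

Lemma vf_0 (k : nat) (a b : R) : vf (k + 3) a b (RtoC 0) = RtoC 0.
Proof. rewrite vf_factor. replace (k + 1)%nat with (S k) by lia. rewrite Cpow_S. ring. Qed.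

(** The exponent is left free because two are needed: k + 1 for comparing solutions, k + 2 for the
    variational equation. *)
Lemma cderiv_inv_pow (k j : nat) (a b : R) (z : R -> C) (t : R) :
  z t <> RtoC 0 -> cderiv z t (vf (k + 3) a b (z t)) ->
  cderiv (fun s => Cinv (Cpow (z s) (S j))) t
    (Copp (Cmult (RtoC (INR (S j)))
       (Cmult (Cinv (Cpow (z t) (S j)))
          (Cmult (Cpow (z t) k) (z t * z t + RtoC a * z t + RtoC b)%C)))).
Proof.
  intros hz H. rewrite vf_factor in H.
  eapply cderiv_eq.
  { apply cderiv_inv; [now apply Cpow_nz |]. apply cderiv_pow, H. }
  replace (k + 1)%nat with (S k) by lia. rewrite !Cpow_S.
  pose proof (Cpow_nz (z t) j hz). field. split; assumption.
Qed.

(** At this exponent [a] enters as a term independent of [z], so it cancels when two solutions are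
    subtracted. *)
Lemma cderiv_inv_pow_crit (k : nat) (a b : R) (z : R -> C) (t : R) :
  z t <> RtoC 0 -> cderiv z t (vf (k + 3) a b (z t)) ->
  cderiv (fun s => Cinv (Cpow (z s) (S k))) t
    (Copp (Cmult (RtoC (INR (S k))) (z t + RtoC a + RtoC b / z t)%C)).
Proof.
  intros hz H. eapply cderiv_eq; [apply (cderiv_inv_pow k k a b z t hz H) |].
  rewrite Cpow_S. pose proof (Cpow_nz (z t) k hz). field. split; assumption.
Qed.

Lemma INR_S_pos (k : nat) : 0 < INR (S k).
Proof. apply lt_0_INR. lia. Qed.

Section Uniqueness.
Variables (k : nat) (omega : R) (alpha beta : R -> R).
Hypothesis homega : 0 < omega.
Hypothesis halpha : cont_itv omega alpha.
Hypothesis hbeta : cont_itv omega beta.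
Hypothesis beta_le : forall t, itv omega t -> beta t <= 0.
Notation sol_ab := (sol (k + 3) omega alpha beta).

Let itv0 : itv omega 0.
Proof. unfold itv; lra. Qed.

Let itvw : itv omega omega.
Proof. unfold itv; lra. Qed.

Lemma sol_zero : sol_ab (fun _ => RtoC 0).
Proof. intros t ht. rewrite vf_0. apply cderiv_const. Qed.

Lemma sol_nonvanishing (z : R -> C) (t0 : R) :
  sol_ab z -> itv omega t0 -> z t0 <> RtoC 0 -> forall t, itv omega t -> z t <> RtoC 0.
Proof.
  intros hz ht0 hn t ht e. apply hn.
  exact (sol_unique_cont _ omega alpha beta homega halpha hbeta z (fun _ => RtoC 0) t
           hz sol_zero ht e t0 ht0).
Qed.

Lemma sol_conj (z : R -> C) : sol_ab z -> sol_ab (fun t => Cconj (z t)).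
Proof. intros hz t ht. rewrite vf_conj. now apply cderiv_conj, hz. Qed.

(* Writing m = k + 1, one has (z^(-m))' = - m (z + alpha + beta / z), so that
   (z1^(-m) - z2^(-m))' = - m (z1 - z2) (1 - beta / (z1 z2)).  With kappa = 1 this
   compares two real solutions, with kappa = i a solution and its conjugate. *)
Lemma no_periodic_pair (z1 z2 : R -> C) (kappa : C) (d p : R -> R) :
  sol_ab z1 -> sol_ab z2 -> kappa <> RtoC 0 ->
  (forall t, itv omega t -> 0 < d t) -> (forall t, itv omega t -> 0 < p t) ->
  (forall t, itv omega t -> Cminus (z1 t) (z2 t) = Cmult kappa (RtoC (d t))) ->
  (forall t, itv omega t -> Cmult (z1 t) (z2 t) = RtoC (p t)) ->
  z1 omega = z1 0 -> z2 omega = z2 0 -> False.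
Proof.
  intros h1 h2 hk hd hp ed ep e1 e2.
  assert (hn : forall t, itv omega t -> z1 t <> RtoC 0 /\ z2 t <> RtoC 0).
  { intros t ht. specialize (hp t ht). specialize (ep t ht).
    split; intros e; rewrite e in ep; apply (f_equal Re) in ep; unfold Re in ep; simpl in ep; lra. }
  (* Division by [kappa] makes the derivative real and positive, so [Re (f t)] increases strictly,
     against periodicity of both solutions. *)
  set (f := fun t => Cmult (Cinv kappa) (Cminus (Cinv (Cpow (z2 t) (S k))) (Cinv (Cpow (z1 t) (S k))))).
  assert (hf : forall t, itv omega t ->
    cderiv f t (RtoC (INR (S k) * (d t * (1 - beta t / p t))))).
  { intros t ht. destruct (hn t ht) as [n1 n2].
    pose proof (hp t ht) as hpt.
    eapply cderiv_eq.
    { apply cderiv_mult; [apply cderiv_const |].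
      apply cderiv_minus; [apply (cderiv_inv_pow_crit k (alpha t) (beta t)) |
        apply (cderiv_inv_pow_crit k (alpha t) (beta t))];
        [exact n2 | now apply h2 | exact n1 | now apply h1]. }
    cbv beta.
    assert (k1 : RtoC (d t) = (/ kappa * (z1 t - z2 t))%C).
    { rewrite (ed t ht). field. exact hk. }
    rewrite !RtoC_mult RtoC_minus RtoC_div; [| lra]. rewrite -(ep t ht) k1.
    field. repeat split; try assumption; now apply Cpow_nz. }
  assert (H : Re (f 0) < Re (f omega)).
  { apply (derive_monotone_strict (fun t => Re (f t))
      (fun t => INR (S k) * (d t * (1 - beta t / p t)))); [exact homega | |].
    - intros t ht. exact (proj1 (hf t ht)).
    - intros t ht. pose proof (hp t ht). pose proof (hd t ht). pose proof (beta_le t ht).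
      apply Rmult_lt_0_compat; [apply INR_S_pos |].
      apply Rmult_lt_0_compat; [assumption |].
      assert (0 < / p t) by (now apply Rinv_0_lt_compat). unfold Rdiv. nra. }
  unfold f in H. rewrite e1 e2 in H. lra.
Qed.

(** A solution that is real at one time coincides with its conjugate, so otherwise Im z never
    vanishes and keeps its sign. Then z and its conjugate have difference 2 i Im z and product
    |z|^2, and [no_periodic_pair] applies. *)
Lemma periodic_real (z : R -> C) :
  sol_ab z -> z omega = z 0 -> forall t, itv omega t -> Im (z t) = 0.
Proof.
  intros hz hper t ht.
  destruct (classic (Im (z 0) = 0)) as [e | hne].
  - assert (e' : z 0 = Cconj (z 0)) by (apply C_eq; unfold Re, Im in *; simpl; lra).
    pose proof (sol_unique_cont _ omega alpha beta homega halpha hbeta z _ 0 hz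
                 (sol_conj z hz) itv0 e' t ht) as H.
    apply (f_equal Im) in H. unfold Im in *; simpl in H. lra.
  - exfalso.
    assert (hn : forall s, itv omega s -> Im (z s) <> 0).
    { intros s hs e. apply hne.
      assert (e' : z s = Cconj (z s)) by (apply C_eq; unfold Re, Im in *; simpl; lra).
      pose proof (sol_unique_cont _ omega alpha beta homega halpha hbeta z _ s hz
                 (sol_conj z hz) hs e' 0 itv0) as H.
      apply (f_equal Im) in H. unfold Im in *; simpl in H. lra. }
    assert (hp : forall s, itv omega s -> 0 < Cmod (z s) ^ 2).
    { intros s hs. rewrite Cmod_sqr. pose proof (hn s hs).
      pose proof (pow2_ge_0 (Re (z s))).
      assert (0 < Im (z s) ^ 2) by (apply pow2_gt_0; assumption). lra. }
    assert (hk : Cmult 2 Ci <> RtoC 0).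
    { intros e. apply (f_equal Im) in e. unfold Im in e; simpl in e. lra. }
    assert (hper' : Cconj (z omega) = Cconj (z 0)) by now rewrite hper.
    destruct (sign_constant omega (fun s => Im (z s))) as [hpos | hneg]; [| exact hn | |].
    + intros s hs. exact (proj2 (cderiv_ccont z s _ (hz s hs))).
    + apply (no_periodic_pair z (fun s => Cconj (z s)) (Cmult 2 Ci)
               (fun s => Im (z s)) (fun s => Cmod (z s) ^ 2)); auto using sol_conj.
      * intros s hs. apply C_eq; unfold Re, Im; simpl; ring.
      * intros s hs. now rewrite -Cmod2_conj.
    + apply (no_periodic_pair (fun s => Cconj (z s)) z (Cmult 2 Ci)
               (fun s => - Im (z s)) (fun s => Cmod (z s) ^ 2)); auto using sol_conj.
      * intros s hs. specialize (hneg s hs). lra.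
      * intros s hs. apply C_eq; unfold Re, Im; simpl; ring.
      * intros s hs. rewrite Cmult_comm. now rewrite -Cmod2_conj.
Qed.

(** Distinct solutions never meet, so their real difference keeps its sign; [no_periodic_pair]
    applies to the larger and the smaller one. *)
Lemma periodic_unique (z1 z2 : R -> C) :
  sol_ab z1 -> sol_ab z2 -> z1 omega = z1 0 -> z2 omega = z2 0 ->
  (forall t, itv omega t -> 0 < Re (z1 t) * Re (z2 t)) -> z1 0 = z2 0.
Proof.
  intros h1 h2 p1 p2 hpos. apply NNPP; intros hne.
  pose proof (periodic_real z1 h1 p1) as r1. pose proof (periodic_real z2 h2 p2) as r2.
  assert (hn : forall t, itv omega t -> Re (z1 t) - Re (z2 t) <> 0).
  { intros t ht e. apply hne.
    apply (sol_unique_cont _ omega alpha beta homega halpha hbeta z1 z2 t h1 h2 ht); [| exact itv0].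
    apply C_eq; [lra |]. now rewrite (r1 t ht) (r2 t ht). }
  assert (hprod : forall t, itv omega t -> Cmult (z1 t) (z2 t) = RtoC (Re (z1 t) * Re (z2 t))).
  { intros t ht. specialize (r1 t ht). specialize (r2 t ht).
    apply C_eq; unfold Re, Im in *; simpl; rewrite r1 r2; ring. }
  destruct (sign_constant omega (fun s => Re (z1 s) - Re (z2 s))) as [hd | hd]; [| exact hn | |].
  - intros t ht.
    exact (@continuous_minus R_UniformSpace R_AbsRing R_NormedModule _ _ t
      (proj1 (cderiv_ccont z1 t _ (h1 t ht))) (proj1 (cderiv_ccont z2 t _ (h2 t ht)))).
  - apply (no_periodic_pair z1 z2 (RtoC 1)
             (fun t => Re (z1 t) - Re (z2 t)) (fun t => Re (z1 t) * Re (z2 t))); auto.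
    + intros e. apply (f_equal Re) in e. unfold Re in e; simpl in e. lra.
    + intros t ht. specialize (r1 t ht). specialize (r2 t ht).
      apply C_eq; unfold Re, Im in *; simpl; rewrite ?r1 ?r2; ring.
  - apply (no_periodic_pair z2 z1 (RtoC 1)
             (fun t => Re (z2 t) - Re (z1 t)) (fun t => Re (z1 t) * Re (z2 t))); auto.
    + intros e. apply (f_equal Re) in e. unfold Re in e; simpl in e. lra.
    + intros t ht. specialize (hd t ht). simpl in hd. lra.
    + intros t ht. specialize (r1 t ht). specialize (r2 t ht).
      apply C_eq; unfold Re, Im in *; simpl; rewrite ?r1 ?r2; ring.
    + intros t ht. rewrite Cmult_comm. now apply hprod.
Qed.

Lemma periodic_sign (z : R -> C) :
  sol_ab z -> z omega = z 0 -> z 0 <> RtoC 0 ->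
  (forall t, itv omega t -> Im (z t) = 0 /\ 0 < Re (z t)) \/
  (forall t, itv omega t -> Im (z t) = 0 /\ Re (z t) < 0).
Proof.
  intros hz hper hn.
  pose proof (periodic_real z hz hper) as hr.
  pose proof (sol_nonvanishing z 0 hz itv0 hn) as hnv.
  destruct (sign_constant omega (fun t => Re (z t))) as [h | h].
  - intros t ht. exact (proj1 (cderiv_ccont z t _ (hz t ht))).
  - intros t ht e. apply (hnv t ht). apply C_eq; [exact e | exact (hr t ht)].
  - left. intros t ht. split; [now apply hr | now apply h].
  - right. intros t ht. split; [now apply hr | now apply h].
Qed.

(* (x^(-m) + m P)' = - m x when beta = 0 and P' = alpha. *)
Lemma periodic_sign_alpha (z : R -> C) (P : R -> R) :
  (forall t, itv omega t -> beta t = 0) ->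
  (forall t, itv omega t -> is_derive P t (alpha t)) ->
  sol_ab z -> z omega = z 0 ->
  ((forall t, itv omega t -> 0 < Re (z t)) -> P omega < P 0) /\
  ((forall t, itv omega t -> Re (z t) < 0) -> P 0 < P omega).
Proof.
  intros b0 hP hz hper.
  assert (hd : (forall t, itv omega t -> Re (z t) <> 0) -> forall t, itv omega t ->
    is_derive (fun s => Re (Cinv (Cpow (z s) (S k))) + INR (S k) * P s) t (- INR (S k) * Re (z t))).
  { intros hn t ht.
    assert (hnz : z t <> RtoC 0) by (intros e; apply (hn t ht); now rewrite e).
    pose proof (proj1 (cderiv_inv_pow_crit k (alpha t) (beta t) z t hnz (hz t ht))) as H.
    rewrite (b0 t ht) in H.
    replace (- INR (S k) * Re (z t)) with
      (Re (- (RtoC (INR (S k)) * (z t + RtoC (alpha t) + 0 / z t)))%C + INR (S k) * alpha t).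
    - apply (@is_derive_plus R_AbsRing R_NormedModule _ _ t _ _ H).
      apply (is_derive_scal P t (INR (S k)) (alpha t)). now apply hP.
    - replace (0 / z t)%C with (RtoC 0) by (field; exact hnz).
      unfold Re. cbn [fst snd Cplus Copp Cmult RtoC]. ring. }
  pose proof (INR_S_pos k) as hk.
  split; intros hs.
  - assert (H : - (Re (Cinv (Cpow (z 0) (S k))) + INR (S k) * P 0)
                < - (Re (Cinv (Cpow (z omega) (S k))) + INR (S k) * P omega)).
    { apply (derive_monotone_strict
        (fun s => - (Re (Cinv (Cpow (z s) (S k))) + INR (S k) * P s))
        (fun s => - (- INR (S k) * Re (z s)))); [exact homega | |].
      - intros t ht. apply (@is_derive_opp R_AbsRing R_NormedModule). apply hd; [| exact ht].
        intros s hs'. specialize (hs s hs'). lra.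
      - intros t ht. specialize (hs t ht). nra. }
    rewrite hper in H. nra.
  - assert (H : Re (Cinv (Cpow (z 0) (S k))) + INR (S k) * P 0
                < Re (Cinv (Cpow (z omega) (S k))) + INR (S k) * P omega).
    { apply (derive_monotone_strict
        (fun s => Re (Cinv (Cpow (z s) (S k))) + INR (S k) * P s)
        (fun s => - INR (S k) * Re (z s))); [exact homega | |].
      - intros t ht. apply hd; [| exact ht].
        intros s hs'. specialize (hs s hs'). lra.
      - intros t ht. specialize (hs t ht). nra. }
    rewrite hper in H. nra.
Qed.

Lemma pow_neg_sign (j : nat) :
  (forall x, x < 0 -> 0 < x ^ j) \/ (forall x, x < 0 -> x ^ j < 0).
Proof.
  induction j as [|j [IH | IH]].
  - left. intros; simpl; lra.
  - right. intros x hx. specialize (IH x hx). simpl. nra.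
  - left. intros x hx. specialize (IH x hx). simpl. nra.
Qed.

(** The exponent n - 1 = k + 2 is the one for which alpha, whose sign is unknown, drops out of the
    logarithmic derivative [rho] of [W]. Since [rho] is real of constant sign, |W|^2 is strictly
    monotone, whereas [D omega] = 1 would make [W] return to its initial value. *)
Lemma variational_ne_1 (z D : R -> C) :
  sol_ab z -> z omega = z 0 -> z 0 <> RtoC 0 -> D 0 = RtoC 1 ->
  (forall t, itv omega t -> cderiv D t (Cmult (vf_d1 (k + 3) (alpha t) (beta t) (z t)) (D t))) ->
  D omega <> RtoC 1.
Proof.
  intros hz hper hn D0 hD D1.
  pose proof (periodic_real z hz hper) as hr.
  pose proof (sol_nonvanishing z 0 hz itv0 hn) as hnv.
  destruct (sol_bounded _ _ _ _ _ homega hz) as [M [hM bM]].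
  destruct (coefficients_extend omega alpha beta homega halpha hbeta)
    as [a [b [A [_ [_ [ba [bb [ea eb]]]]]]]].
  destruct (vf_d_bound (k + 3) A M) as [K [hK bK]];
    [eapply Rle_trans; [apply Rabs_pos | apply (ba 0)] | exact hM |].
  assert (Dn : forall t, itv omega t -> D t <> RtoC 0).
  { intros t ht e.
    pose proof (gronwall_lower omega K D _ hD t) as G.
    rewrite e D0 Cmod_0 Cmod_1 in G.
    assert (1 ^ 2 <= 0 ^ 2 * exp (2 * K * t)); [| simpl in *; lra].
    apply G; [| exact ht].
    intros s hs. rewrite Cmod_mult. apply Rmult_le_compat_r; [apply Cmod_ge_0 |].
    rewrite <- (ea s hs), <- (eb s hs). now apply bK; auto. }
  set (W := fun t => Cmult (D t) (Cinv (Cpow (z t) (S (S k))))).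
  set (rho := fun t => Re (z t) ^ k * (Re (z t) ^ 2 - beta t)).
  assert (hW : forall t, itv omega t -> cderiv W t (Cmult (RtoC (rho t)) (W t))).
  { intros t ht. eapply cderiv_eq.
    { apply cderiv_mult; [now apply hD |].
      apply (cderiv_inv_pow k (S k) (alpha t) (beta t)); [now apply hnv | now apply hz]. }
    unfold W, rho, vf_d1.
    replace (k + 3 - 1)%nat with (S (S k)) by lia. replace (k + 3 - 2)%nat with (S k) by lia.
    replace (k + 3)%nat with (S (S (S k))) by lia.
    rewrite !pow_d1_eq.
    assert (ez : z t = RtoC (Re (z t))) by (apply C_eq; [reflexivity | exact (hr t ht)]).
    rewrite RtoC_mult RtoC_minus !RtoC_pow -ez.
    rewrite !S_INR !RtoC_plus !Cpow_S.
    pose proof (hnv t ht). pose proof (Cpow_nz (z t) k H).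
    set (y := z t) in *. set (i := RtoC (INR k)). set (yk := Cpow y k) in *.
    change (Cpow y 0) with (RtoC 1).
    field. split; assumption. }
  assert (Wn : forall t, itv omega t -> 0 < Cmod (W t) ^ 2).
  { intros t ht. apply pow_lt. apply Cmod_gt_0. unfold W.
    apply Cmult_neq_0; [now apply Dn |].
    intros e. pose proof (Cinv_r (Cpow (z t) (S (S k)))) as h.
    rewrite e in h. specialize (h (Cpow_nz _ _ (hnv t ht))).
    apply (f_equal Re) in h. unfold Re in h; simpl in h. lra. }
  assert (WW : W omega = W 0) by (unfold W; now rewrite hper D1 D0).
  assert (dW : forall t, itv omega t ->
    is_derive (fun s => Cmod (W s) ^ 2) t (2 * rho t * Cmod (W t) ^ 2)).
  { intros t ht. pose proof (cderiv_norm2 W t _ (hW t ht)) as H.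
    replace (2 * rho t * Cmod (W t) ^ 2) with
      (2 * (Re (W t) * Re (RtoC (rho t) * W t)%C + Im (W t) * Im (RtoC (rho t) * W t)%C));
      [exact H |].
    rewrite Cmod_sqr. unfold Re, Im. cbn [fst snd Cmult RtoC]. ring. }
  assert (hsgn : (forall t, itv omega t -> 0 < rho t) \/ (forall t, itv omega t -> rho t < 0)).
  { assert (hq : forall t, itv omega t -> Re (z t) <> 0 -> 0 < Re (z t) ^ 2 - beta t).
    { intros t ht h. pose proof (beta_le t ht).
      assert (0 < Re (z t) ^ 2) by (apply pow2_gt_0; assumption). lra. }
    destruct (periodic_sign z hz hper hn) as [h | h].
    - left. intros t ht. destruct (h t ht) as [_ hp]. apply Rmult_lt_0_compat.
      + now apply pow_lt.
      + apply hq; [exact ht | lra].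
    (* For a negative solution the sign of [rho] is that of x^k, fixed by the parity of [k]; either
       sign contradicts the return of [W]. *)
    - destruct (pow_neg_sign k) as [hs | hs].
      + left. intros t ht. destruct (h t ht) as [_ hp]. apply Rmult_lt_0_compat.
        * now apply hs.
        * apply hq; [exact ht | lra].
      + right. intros t ht. destruct (h t ht) as [_ hp].
        specialize (hs _ hp). assert (0 < Re (z t) ^ 2 - beta t) by (apply hq; [exact ht | lra]).
        unfold rho. nra. }
  destruct hsgn as [hs | hs].
  - assert (H : Cmod (W 0) ^ 2 < Cmod (W omega) ^ 2).
    { apply (derive_monotone_strict (fun s => Cmod (W s) ^ 2)
        (fun t => 2 * rho t * Cmod (W t) ^ 2)); [exact homega | exact dW |].
      intros t ht. pose proof (hs t ht). pose proof (Wn t ht). nra. }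
    rewrite WW in H. lra.
  - assert (H : - Cmod (W 0) ^ 2 < - Cmod (W omega) ^ 2).
    { apply (derive_monotone_strict (fun s => - Cmod (W s) ^ 2)
        (fun t => - (2 * rho t * Cmod (W t) ^ 2))); [exact homega | |].
      - intros t ht. apply (@is_derive_opp R_AbsRing R_NormedModule). now apply dW.
      - intros t ht. pose proof (hs t ht). pose proof (Wn t ht). nra. }
    rewrite WW in H. lra.
Qed.
End Uniqueness.

(** * Existence of periodic solutions *)

Lemma cderiv_comp (z : R -> C) (f : R -> R) (t df : R) (l : C) :
  is_derive f t df -> cderiv z (f t) l ->
  cderiv (fun s => z (f s)) t (Cmult (RtoC df) l).
Proof.
  intros hf [H1 H2]. split.
  - replace (Re (RtoC df * l)%C) with (df * Re l) by (unfold Re; simpl; ring).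
    exact (is_derive_comp (fun s => Re (z s)) f t _ _ H1 hf).
  - replace (Im (RtoC df * l)%C) with (df * Im l) by (unfold Im; simpl; ring).
    exact (is_derive_comp (fun s => Im (z s)) f t _ _ H2 hf).
Qed.

(** [dP] and [dS] stand for the integrals of alpha and beta, and y for an upper bound on a small
    positive solution; the inequality is the one that makes such a solution decrease over one
    period. *)
Lemma exists_small_negative (omega r dP dS : R) :
  0 < omega -> 0 < r -> (dS < 0 \/ (dS = 0 /\ dP < 0)) ->
  exists y, 0 < y <= r /\ dP + dS / y + y * omega < 0.
Proof.
  intros hw hr [hS | [hS hP]].
  (* With y <= 1 and dS / y <= - q, the sum is at most dP - q + omega <= -1. *)
  - set (q := Rabs dP + omega + 1).
    assert (hq : 0 < q) by (unfold q; pose proof (Rabs_pos dP); lra).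
    set (y := Rmin (Rmin r 1) (- dS / q)).
    assert (hy : 0 < y).
    { unfold y. repeat apply Rmin_pos; try lra. apply Rdiv_lt_0_compat; lra. }
    assert (hy1 : y <= 1) by (unfold y; eapply Rle_trans; [apply Rmin_l | apply Rmin_r]).
    assert (hy2 : y <= - dS / q) by apply Rmin_r.
    exists y. split; [split; [exact hy | unfold y; eapply Rle_trans; apply Rmin_l] |].
    assert (h : dS / y <= - q).
    { apply Rle_div_l; [lra |]. apply Rle_div_r in hy2; lra. }
    pose proof (Rle_abs dP). unfold q in h. nra.
  - exists (Rmin r (- dP / (2 * omega))).
    assert (h : 0 < - dP / (2 * omega)) by (apply Rdiv_lt_0_compat; lra).
    pose proof (Rmin_l r (- dP / (2 * omega))). pose proof (Rmin_r r (- dP / (2 * omega))).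
    set (y := Rmin _ _) in *.
    assert (hy : 0 < y) by now apply Rmin_pos.
    split; [lra |]. rewrite hS. unfold Rdiv at 1. rewrite Rmult_0_l.
    apply Rle_div_r in H0; nra.
Qed.

Lemma pow_inv_lt (x y : R) (j : nat) : 0 < x -> 0 < y -> / y ^ S j < / x ^ S j -> x < y.
Proof.
  intros hx hy h.
  destruct (Rlt_le_dec x y) as [h' | h']; [exact h' |].
  exfalso. apply (Rlt_irrefl (/ y ^ S j)). eapply Rlt_le_trans; [exact h |].
  apply Rinv_le_contravar; [now apply pow_lt | apply pow_incr; lra].
Qed.

(** * Positive periodic solutions through the truncated equation *)

Section Truncation.
Variables (k : nat) (omega A : R) (a b : R -> R).
Hypothesis homega : 0 < omega.
Hypothesis a_cont : forall t, continuous a t.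
Hypothesis b_cont : forall t, continuous b t.
Hypothesis a_bd : forall t, Rabs (a t) <= A.
Hypothesis b_bd : forall t, Rabs (b t) <= A.

(** As |a|, |b| <= A, one has r^2 + a r + b >= r (r - A) - A = A + 4 > 0, so the field is positive
    at level r. *)
Let r := A + 2.
Let F (t : R) (x : C) := vf (k + 3) (a t) (b t) (cclip r x).

Definition trunc_sol (T0 T : R) (z : R -> C) : Prop :=
  forall t, T0 <= t <= T -> cderiv z t (F t (z t)).

Lemma A_ge_0 : 0 <= A.
Proof. eapply Rle_trans; [apply Rabs_pos | apply (a_bd 0)]. Qed.

Lemma trunc_lipschitz : exists K, 0 < K /\
  forall t x y, Cmod (Cminus (F t x) (F t y)) <= K * Cmod (Cminus x y).
Proof.
  pose proof A_ge_0 as hA.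
  assert (hr : 0 <= r) by (unfold r; lra).
  destruct (vf_lipschitz (k + 3) A (2 * r)) as [K [hK h]]; [lra | lra |].
  exists K. split; [exact hK |]. intros t x y. unfold F.
  eapply Rle_trans; [apply h; auto using cclip_bound |].
  apply Rmult_le_compat_l; [lra | now apply cclip_lip].
Qed.

(** The starting time is arbitrary because solutions are also compared from the time at which they
    reach level r; [G] depends only on the length of the interval. *)
Lemma trunc_dependence (T : R) : 0 < T -> exists G, 1 <= G /\ forall T0 z w,
  trunc_sol T0 (T0 + T) z -> trunc_sol T0 (T0 + T) w ->
  forall t, T0 <= t <= T0 + T -> Cmod (Cminus (z t) (w t)) <= G * Cmod (Cminus (z T0) (w T0)).
Proof.
  intros hT. destruct trunc_lipschitz as [K [hK h]].
  destruct (gronwall_bound T K hT (Rlt_le _ _ hK)) as [G [hG g]].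
  exists G. split; [exact hG |]. intros T0 z w hz hw t ht.
  assert (sh : forall u, trunc_sol T0 (T0 + T) u -> forall s, itv T s ->
            cderiv (fun s => u (T0 + s)) s (F (T0 + s) (u (T0 + s)))).
  { intros u hu s hs. eapply cderiv_eq.
    - apply (cderiv_comp u (fun s => T0 + s) s 1); [| apply hu; unfold itv in hs; lra].
      auto_derive; trivial.
    - ring. }
  pose proof (g (fun s => Cminus (z (T0 + s)) (w (T0 + s)))
    (fun s => Cminus (F (T0 + s) (z (T0 + s))) (F (T0 + s) (w (T0 + s)))) 0 (Rle_refl 0)) as H.
  specialize (H (fun s hs => cderiv_minus _ _ _ _ _ (sh z hz s hs) (sh w hw s hs))).
  specialize (H ltac:(intros s hs; rewrite Rplus_0_r; apply h) (t - T0)).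
  cbv beta in H. rewrite !Rplus_0_r in H.
  replace (T0 + (t - T0)) with t in H by ring.
  apply H. unfold itv. lra.
Qed.

Lemma trunc_real (z : R -> C) : trunc_sol 0 omega z -> Im (z 0) = 0 ->
  forall t, itv omega t -> Im (z t) = 0.
Proof.
  intros hz h0 t ht. pose proof A_ge_0.
  destruct (trunc_dependence omega homega) as [G [hG g]].
  assert (hc : trunc_sol 0 omega (fun t => Cconj (z t))).
  { intros s hs. unfold F. rewrite cclip_conj; [| unfold r; lra]. rewrite vf_conj.
    apply cderiv_conj. now apply hz. }
  specialize (g 0 z (fun t => Cconj (z t))). rewrite Rplus_0_l in g.
  specialize (g hz hc t ht).
  replace (z 0 - Cconj (z 0))%C with (RtoC 0) in g
    by (apply C_eq; unfold Re, Im in *; simpl; lra).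
  rewrite Cmod_0 Rmult_0_r in g.
  pose proof (im_le_Cmod (z t - Cconj (z t))%C) as h.
  replace (Im (z t - Cconj (z t))%C) with (2 * Im (z t)) in h by (unfold Im; simpl; ring).
  rewrite Rabs_mult (Rabs_pos_eq 2) in h; [| lra].
  pose proof (Rabs_pos (Im (z t))).
  destruct (Req_dec (Im (z t)) 0) as [e | e]; [exact e |].
  pose proof (Rabs_pos_lt _ e). lra.
Qed.

Lemma trunc_F_0 (t : R) : F t (RtoC 0) = RtoC 0.
Proof.
  pose proof A_ge_0. unfold F. rewrite cclip_id; [apply vf_0 |]. rewrite Cmod_0. unfold r; lra.
Qed.

(** The truncated field is Lipschitz and vanishes at 0, so by the lower Gronwall estimate a solution
    starting off 0 never reaches it; being real, it keeps its sign. *)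
Lemma trunc_positive (z : R -> C) : trunc_sol 0 omega z -> Im (z 0) = 0 -> 0 < Re (z 0) ->
  forall t, itv omega t -> 0 < Re (z t).
Proof.
  intros hz hi hp.
  destruct trunc_lipschitz as [K [hK h]].
  destruct (sign_constant omega (fun t => Re (z t))) as [H | H]; [| | exact H |].
  - intros t ht. exact (proj1 (cderiv_ccont z t _ (hz t ht))).
  - intros t ht e.
    assert (e' : z t = RtoC 0) by (apply C_eq; [exact e | now apply trunc_real]).
    pose proof (gronwall_lower omega K z _ hz t) as G.
    rewrite e' Cmod_0 in G.
    assert (G' : Cmod (z 0) ^ 2 <= 0 ^ 2 * exp (2 * K * t)).
    { apply G; [| exact ht]. intros s hs.
      pose proof (h s (z s) (RtoC 0)) as hh. rewrite trunc_F_0 in hh.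
      now rewrite /Cminus Copp_0 !Cplus_0_r in hh. }
    rewrite Cmod_sqr hi in G'.
    assert (0 < Re (z 0) ^ 2) by (apply pow_lt; exact hp). simpl in *. lra.
  - assert (h0 : itv omega 0) by (unfold itv; lra). specialize (H 0 h0). simpl in H. lra.
Qed.

Lemma vf_real (t x : R) : vf (k + 3) (a t) (b t) (RtoC x)
  = RtoC (x ^ (k + 1) * (x * x + a t * x + b t)).
Proof. rewrite vf_factor RtoC_mult RtoC_pow !RtoC_plus !RtoC_mult. reflexivity. Qed.

(* Above the level r the truncated field is positive and independent of the
   unknown, so the solution there is an explicit primitive. *)
Lemma trunc_escape (z : R -> C) (t1 : R) : trunc_sol 0 omega z -> Im (z 0) = 0 ->
  0 <= t1 < omega -> r <= Re (z t1) -> Re (z t1) < Re (z omega).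
Proof.
  intros hz hi ht1 hr. pose proof A_ge_0 as hA.
  assert (hr0 : 0 <= r) by (unfold r; lra).
  set (v := fun t => r ^ (k + 1) * (r * r + a t * r + b t)).
  assert (hv : forall t, 0 < v t).
  { intros t. unfold v. apply Rmult_lt_0_compat; [apply pow_lt; unfold r; lra |].
    pose proof (a_bd t) as h1. pose proof (b_bd t) as h2. apply Rabs_le_between in h1, h2.
    unfold r. nra. }
  assert (vc : forall t, continuous v t).
  { intros t. unfold v. apply continuous_Rmult; [apply continuous_const |].
    apply (@continuous_plus R_UniformSpace R_AbsRing R_NormedModule
             (fun s => r * r + a s * r) b); [| apply b_cont].
    apply (@continuous_plus R_UniformSpace R_AbsRing R_NormedModule
             (fun s => r * r) (fun s => a s * r)); [apply continuous_const |].
    apply continuous_Rmult; [apply a_cont | apply continuous_const]. }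
  set (V := fun t => RInt v 0 t).
  assert (dV : forall t, is_derive V t (v t)).
  { intros t. now apply (is_derive_primitive R_CompleteNormedModule v t). }
  assert (Vmono : forall s t, s < t -> V s < V t).
  { intros s t hst. apply (derive_monotone_strict V v); auto. }
  set (w := fun t => RtoC (Re (z t1) + (V t - V t1))).
  destruct (trunc_dependence (omega - t1)) as [G [hG g]]; [lra |].
  specialize (g t1 z w). replace (t1 + (omega - t1)) with omega in g by ring.
  assert (e1 : z t1 = w t1).
  { unfold w. apply C_eq.
    - unfold Re; simpl. ring.
    - rewrite (trunc_real z hz hi t1); [reflexivity | unfold itv; lra]. }
  assert (hz' : trunc_sol t1 omega z) by (intros t ht; apply hz; lra).
  assert (hw' : trunc_sol t1 omega w).
  { intros t ht. unfold F, w, cclip.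
    assert (hVt : V t1 <= V t).
    { destruct (Req_dec t1 t) as [-> | hne]; [lra |]. left. apply Vmono. lra. }
    rewrite (clip_ge r (Re (RtoC (Re (z t1) + (V t - V t1))))); [| exact hr0 | unfold Re in *; simpl; lra].
    rewrite (clip_id r (Im (RtoC (Re (z t1) + (V t - V t1))))).
    2: { unfold Im; simpl. rewrite Rabs_R0. exact hr0. }
    change (r, Im (RtoC (Re (z t1) + (V t - V t1)))) with (RtoC r).
    rewrite vf_real. apply cderiv_real. fold (v t).
    replace (v t) with (0 + (v t - 0)) by ring.
    apply (@is_derive_plus R_AbsRing R_NormedModule (fun _ => Re (z t1)) (fun s => V s - V t1));
      [apply @is_derive_const |].
    apply (@is_derive_minus R_AbsRing R_NormedModule V (fun _ => V t1)); [apply dV | apply @is_derive_const]. }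
  specialize (g hz' hw' omega ltac:(lra)).
  rewrite e1 in g. replace (w t1 - w t1)%C with (RtoC 0) in g by ring.
  rewrite Cmod_0 Rmult_0_r in g.
  assert (e2 : z omega = w omega).
  { replace (z omega) with ((z omega - w omega) + w omega)%C by ring.
    rewrite (Cmod_eq_0 (z omega - w omega)%C); [ring |]. pose proof (Cmod_ge_0 (z omega - w omega)%C). lra. }
  rewrite e2. unfold w. unfold Re at 2; simpl.
  specialize (Vmono t1 omega ltac:(lra)). lra.
Qed.

Lemma trunc_below (z : R -> C) :
  trunc_sol 0 omega z -> (forall t, itv omega t -> Cmod (z t) <= r) ->
  sol (k + 3) omega a b z.
Proof.
  intros hz hb t ht. specialize (hz t ht). unfold F in hz.
  now rewrite (cclip_id r (z t) (hb t ht)) in hz.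
Qed.

Lemma real_Cmod (z : C) : Im z = 0 -> 0 < Re z -> Cmod z = Re z.
Proof.
  intros hi hp. replace z with (RtoC (Re z)) at 1 by (apply C_eq; [reflexivity | now rewrite hi]).
  rewrite Cmod_R. apply Rabs_pos_eq. lra.
Qed.

Variables (P S : R -> R).
Hypothesis b_le : forall t, itv omega t -> b t <= 0.
Hypothesis dP : forall t, itv omega t -> is_derive P t (a t).
Hypothesis dS : forall t, itv omega t -> is_derive S t (b t).

(* For a solution 0 < x <= y, the function x^(-m) + m (P + S / y + y t) is nondecreasing. *)
Lemma small_decreases (z : R -> C) (y : R) :
  sol (k + 3) omega a b z -> 0 < y ->
  (forall t, itv omega t -> Im (z t) = 0 /\ 0 < Re (z t) <= y) ->
  (P omega - P 0) + (S omega - S 0) / y + y * omega < 0 ->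
  Re (z omega) < Re (z 0).
Proof.
  intros hz hy hb hneg.
  assert (h0 : itv omega 0) by (unfold itv; lra).
  assert (hwm : itv omega omega) by (unfold itv; lra).
  pose proof (INR_S_pos k) as hk.
  assert (hI : forall t, itv omega t -> Re (Cinv (Cpow (z t) (Datatypes.S k))) = / Re (z t) ^ Datatypes.S k).
  { intros t ht. destruct (hb t ht) as [e hp].
    replace (z t) with (RtoC (Re (z t))) at 1 by (apply C_eq; [reflexivity | now rewrite e]).
    rewrite <- RtoC_pow, <- RtoC_inv; [reflexivity |]. apply pow_nonzero. lra. }
  apply (pow_inv_lt _ _ k); [apply hb, hwm | apply hb, h0 |].
  rewrite <- (hI 0 h0), <- (hI omega hwm).
  set (Q := fun t => P t + S t / y + y * t).
  assert (H : Re (Cinv (Cpow (z 0) (Datatypes.S k))) + INR (Datatypes.S k) * Q 0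
              <= Re (Cinv (Cpow (z omega) (Datatypes.S k))) + INR (Datatypes.S k) * Q omega).
  { apply (derive_monotone
      (fun t => Re (Cinv (Cpow (z t) (Datatypes.S k))) + INR (Datatypes.S k) * Q t)
      (fun t => INR (Datatypes.S k) * ((y - Re (z t)) + b t * (/ y - / Re (z t))))); [lra | |].
    - intros t ht. destruct (hb t ht) as [e [hp hle]].
      assert (hnz : z t <> RtoC 0) by (intros e'; rewrite e' in hp; unfold Re in hp; simpl in hp; lra).
      pose proof (proj1 (cderiv_inv_pow_crit k (a t) (b t) z t hnz (hz t ht))) as H.
      assert (HQ : is_derive Q t (a t + b t / y + y)).
      { unfold Q. apply (@is_derive_plus R_AbsRing R_NormedModule (fun s => P s + S s / y) (fun s => y * s)).
        - apply (@is_derive_plus R_AbsRing R_NormedModule P (fun s => S s / y)); [now apply dP |].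
          unfold Rdiv. apply (is_derive_ext (fun s => / y * S s)); [intros s; apply Rmult_comm |].
          rewrite Rmult_comm. apply (is_derive_scal S t (/ y) (b t)). now apply dS.
        - auto_derive; trivial. ring. }
      replace (INR (Datatypes.S k) * (y - Re (z t) + b t * (/ y - / Re (z t)))) with
        (Re (- (RtoC (INR (Datatypes.S k)) * (z t + RtoC (a t) + RtoC (b t) / z t)))%C
         + INR (Datatypes.S k) * (a t + b t / y + y)).
      + apply (@is_derive_plus R_AbsRing R_NormedModule _ _ t _ _ H).
        apply (is_derive_scal Q t (INR (Datatypes.S k))). exact HQ.
      + replace (z t) with (RtoC (Re (z t))) by (apply C_eq; [reflexivity | now rewrite e]).
        set (x := Re (z t)) in *. rewrite -RtoC_div; [| lra].
        unfold Re. cbn [fst snd Cplus Copp Cmult RtoC]. field. lra.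
    - intros t ht. destruct (hb t ht) as [e [hp hle]]. pose proof (b_le t ht).
      apply Rmult_le_pos; [lra |].
      assert (/ y <= / Re (z t)) by (apply Rinv_le_contravar; assumption). nra. }
  assert (INR (Datatypes.S k) * (Q omega - Q 0) < 0).
  { assert (Q omega - Q 0 < 0); [| nra]. unfold Q.
    replace (P omega + S omega / y + y * omega - (P 0 + S 0 / y + y * 0))
      with (P omega - P 0 + (S omega - S 0) / y + y * omega) by (field; lra). exact hneg. }
  lra.
Qed.

Lemma exists_positive_periodic :
  (S omega - S 0 < 0 \/ (S omega - S 0 = 0 /\ P omega - P 0 < 0)) ->
  exists z, sol (k + 3) omega a b z /\ z omega = z 0 /\
    forall t, itv omega t -> Im (z t) = 0 /\ 0 < Re (z t).
Proof.
  intros hPS. pose proof A_ge_0 as hA.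
  assert (hr : 0 < r) by (unfold r; lra).
  assert (h0 : itv omega 0) by (unfold itv; lra).
  assert (hwm : itv omega omega) by (unfold itv; lra).
  pose proof (fun c : R => trunc_flow (k + 3) omega A r a b homega (Rlt_le _ _ hr) a_cont b_cont a_bd b_bd (RtoC c))
    as hex.
  (* Choosing one solution per initial value makes the return map a function of [c], to which the
     intermediate value theorem can be applied. *)
  set (Z := fun c => proj1_sig (constructive_indefinite_description _ (hex c))).
  assert (Z0 : forall c, Z c 0 = RtoC c).
  { intros c. exact (proj1 (proj2_sig (constructive_indefinite_description _ (hex c)))). }
  assert (hZ : forall c, trunc_sol 0 omega (Z c)).
  { intros c. exact (proj2 (proj2_sig (constructive_indefinite_description _ (hex c)))). }
  clearbody Z. clear hex.
  assert (hZi : forall c, Im (Z c 0) = 0) by (intros c; now rewrite Z0).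
  assert (hZp : forall c, 0 < c -> forall t, itv omega t -> 0 < Re (Z c t)).
  { intros c hc. apply trunc_positive; [apply hZ | apply hZi | now rewrite Z0]. }
  destruct (trunc_dependence omega homega) as [G [hG g]].
  specialize (g 0). rewrite Rplus_0_l in g.
  set (h := fun c => Re (Z c omega) - c).
  assert (hcont : forall c, continuous h c).
  { intros c. apply (@continuous_minus R_UniformSpace R_AbsRing R_NormedModule
                       (fun c => Re (Z c omega)) (fun c => c)); [| apply continuous_id].
    apply filterlim_locally. intros eps.
    assert (he : 0 < eps / G) by (apply Rdiv_lt_0_compat; [apply eps | lra]).
    exists (mkposreal _ he). intros c' hc'. change (Rabs (c' - c) < eps / G) in hc'.
    change (Rabs (Re (Z c' omega) - Re (Z c omega)) < eps).
    pose proof (g _ _ (hZ c') (hZ c) omega hwm) as H.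
    rewrite !Z0 -RtoC_minus Cmod_R in H.
    pose proof (re_le_Cmod (Z c' omega - Z c omega)%C) as H2.
    change (Re (Z c' omega - Z c omega)%C) with (Re (Z c' omega) - Re (Z c omega)) in H2.
    apply Rlt_div_r in hc'; [| lra]. lra. }
  destruct (exists_small_negative omega r (P omega - P 0) (S omega - S 0) homega hr hPS)
    as [y [[hy hyr] hneg]].
  (* By comparison with the zero solution, starting at y / G keeps the solution below [y] up to time
     omega. *)
  set (c0 := y / G).
  assert (hc0 : 0 < c0) by (apply Rdiv_lt_0_compat; lra).
  assert (hc0y : G * c0 = y) by (unfold c0; field; lra).
  assert (hzero : trunc_sol 0 omega (fun _ => RtoC 0)).
  { intros t _. rewrite trunc_F_0. apply cderiv_const. }
  assert (hsmall : h c0 < 0).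
  { assert (hb : forall t, itv omega t -> Cmod (Z c0 t) <= y).
    { intros t ht. pose proof (g _ _ (hZ c0) hzero t ht) as H.
      rewrite Z0 in H. rewrite /Cminus Copp_0 !Cplus_0_r Cmod_R in H.
      rewrite Rabs_pos_eq in H; lra. }
    assert (hs : sol (k + 3) omega a b (Z c0)).
    { apply trunc_below; [apply hZ |]. intros t ht. specialize (hb t ht). lra. }
    unfold h. pose proof (small_decreases (Z c0) y hs hy) as H.
    rewrite Z0 in H. change (Re (RtoC c0)) with c0 in H.
    assert (Re (Z c0 omega) < c0); [| lra]. apply H; [| exact hneg].
    intros t ht. split; [now apply (trunc_real (Z c0)); auto |].
    split; [now apply hZp |].
    eapply Rle_trans; [| apply (hb t ht)]. eapply Rle_trans; [apply Rle_abs | apply re_le_Cmod]. }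
  assert (hlarge : 0 < h r).
  { unfold h. pose proof (trunc_escape (Z r) 0 (hZ r) (hZi r)) as H.
    rewrite Z0 in H. change (Re (RtoC r)) with r in H.
    assert (r < Re (Z r omega)); [| lra]. apply H; lra. }
  assert (hc0r : c0 < r).
  { assert (c0 <= r).
    { apply Rle_trans with y; [| exact hyr]. rewrite <- hc0y. nra. }
    destruct (Req_dec c0 r) as [e | e]; [rewrite e in hsmall; lra | lra]. }
  destruct (Ranalysis5.IVT_interv h c0 r) as [c [hc e]]; try assumption.
  { intros c _. apply continuity_pt_filterlim, hcont. }
  assert (hcr : c < r).
  { destruct (Req_dec c r) as [e' | e']; [rewrite e' in e; lra | lra]. }
  assert (hper : Re (Z c omega) = c) by (unfold h in e; lra).
  assert (hreal : forall t, itv omega t -> Im (Z c t) = 0) by (apply trunc_real; auto).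
  assert (hpos : forall t, itv omega t -> 0 < Re (Z c t)) by (apply hZp; lra).
  exists (Z c). split; [| split].
  - apply trunc_below; [apply hZ |]. intros t ht.
    rewrite real_Cmod; [| now apply hreal | now apply hpos].
    (* Exceeding r before time omega would mean ending above r > c, against [hper]. *)
    destruct (Rle_lt_dec (Re (Z c t)) r) as [hle | hlt]; [exact hle |].
    destruct (Req_dec t omega) as [et | et]; [rewrite et in hlt; lra |].
    pose proof (trunc_escape (Z c) t (hZ c) (hZi c)) as H.
    unfold itv in ht. specialize (H ltac:(lra) ltac:(lra)). lra.
  - rewrite Z0. apply C_eq; [exact hper | now apply hreal].
  - intros t ht. split; [now apply hreal | now apply hpos].
Qed.
End Truncation.

(** * Counting *)

Lemma Cpow_opp (z : C) (n : nat) :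
  Cpow (Copp z) n = if Nat.even n then Cpow z n else Copp (Cpow z n).
Proof.
  induction n as [|n IH]; [reflexivity |].
  rewrite Nat.even_succ -Nat.negb_even !Cpow_S IH.
  destruct (Nat.even n); simpl; ring.
Qed.

(** The parity of z^(k+1) decides: for even [k] the substitution z -> -z only changes the sign of
    [a], for odd [k] it also reverses time. *)
Lemma vf_opp (k : nat) (a b : R) (z : C) :
  vf (k + 3) a b (Copp z) =
  if Nat.even k then Copp (vf (k + 3) (- a) b z) else vf (k + 3) (- a) b z.
Proof.
  rewrite !vf_factor Cpow_opp Nat.add_1_r Nat.even_succ -Nat.negb_even RtoC_opp.
  destruct (Nat.even k); simpl; ring.
Qed.

Section Negative.
Variables (k : nat) (omega A : R) (a b P S : R -> R).
Hypothesis homega : 0 < omega.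
Hypothesis a_cont : forall t, continuous a t.
Hypothesis b_cont : forall t, continuous b t.
Hypothesis a_bd : forall t, Rabs (a t) <= A.
Hypothesis b_bd : forall t, Rabs (b t) <= A.
Hypothesis b_le : forall t, itv omega t -> b t <= 0.
Hypothesis dP : forall t, itv omega t -> is_derive P t (a t).
Hypothesis dS : forall t, itv omega t -> is_derive S t (b t).

(* z is negative iff - z(t) (n odd), resp. - z(omega - t) (n even), is positive;
   both substitutions keep the form of the equation. *)
Lemma exists_negative_periodic :
  (S omega - S 0 < 0 \/ (S omega - S 0 = 0 /\ 0 < P omega - P 0)) ->
  exists z, sol (k + 3) omega a b z /\ z omega = z 0 /\
    forall t, itv omega t -> Im (z t) = 0 /\ Re (z t) < 0.
Proof.
  intros hPS. destruct (Nat.even k) eqn:ek.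
  - destruct (exists_positive_periodic k omega A (fun t => - a t) b homega) with
      (P := fun t => - P t) (S := S) as [z [hz [hper hpos]]]; auto.
    + intros t. apply (@continuous_opp R_UniformSpace R_AbsRing R_NormedModule a t), a_cont.
    + intros t. rewrite Rabs_Ropp. apply a_bd.
    + intros t ht. apply (@is_derive_opp R_AbsRing R_NormedModule). now apply dP.
    + lra.
    + exists (fun t => Copp (z t)). split; [| split; [now rewrite hper |]].
      * intros t ht. rewrite vf_opp ek. apply cderiv_opp. now apply hz.
      * intros t ht. destruct (hpos t ht). unfold Re, Im in *; simpl. lra.
  - set (s := fun t => omega - t).
    assert (hs : forall t, itv omega t -> itv omega (s t)) by (unfold itv, s; intros; lra).
    assert (ds : forall t, is_derive s t (- 1)).
    { intros t. unfold s. auto_derive; [exact I | ring]. }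
    assert (cs : forall t, continuous s t).
    { intros t. apply (@ex_derive_continuous R_AbsRing R_NormedModule). now exists (- 1). }
    assert (ss : forall t, s (s t) = t) by (unfold s; intros; ring).
    (* Under reversal together with the sign change of [a], the first primitive becomes P(s t) and
       the second - S(s t): the increment of the first changes sign, that of the second is kept. *)
    destruct (exists_positive_periodic k omega A (fun t => - a (s t)) (fun t => b (s t)) homega)
      with (P := fun t => P (s t)) (S := fun t => - S (s t)) as [z [hz [hper hpos]]]; auto.
    + intros t. apply (@continuous_opp R_UniformSpace R_AbsRing R_NormedModule (fun t => a (s t)) t).
      apply (continuous_comp s a); [apply cs | apply a_cont].
    + intros t. apply (continuous_comp s b); [apply cs | apply b_cont].
    + intros t. rewrite Rabs_Ropp. apply a_bd.
    + intros t ht. replace (- a (s t)) with (- 1 * a (s t)) by ring.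
      apply (is_derive_comp P s t (a (s t)) (- 1)); [now apply dP, hs | apply ds].
    + intros t ht. replace (b (s t)) with (- (- 1 * b (s t))) by ring.
      apply (@is_derive_opp R_AbsRing R_NormedModule).
      apply (is_derive_comp S s t (b (s t)) (- 1)); [now apply dS, hs | apply ds].
    + replace (s omega) with 0 by (unfold s; ring). replace (s 0) with omega by (unfold s; ring). lra.
    + exists (fun t => Copp (z (s t))). split; [| split].
      * intros t ht. rewrite vf_opp ek.
        specialize (hz (s t) (hs t ht)). cbv beta in hz. rewrite !(ss t) in hz.
        eapply cderiv_eq; [apply cderiv_opp, (cderiv_comp z s t (- 1) _ (ds t) hz) |].
        replace (RtoC (- 1)) with (Copp 1) by (now rewrite -RtoC_opp). ring.
      * replace (s omega) with 0 by (unfold s; ring). replace (s 0) with omega by (unfold s; ring).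
        now rewrite hper.
      * intros t ht. destruct (hpos (s t) (hs t ht)). unfold Re, Im in *; simpl. lra.
Qed.
End Negative.

(** [S] is nonincreasing with equal end values, hence constant on the interval, and its derivative
    [b] vanishes there. *)
Lemma zero_of_integral_zero (omega : R) (b S : R -> R) :
  0 < omega -> (forall t, itv omega t -> b t <= 0) ->
  (forall t, itv omega t -> is_derive S t (b t)) -> S omega = S 0 ->
  forall t, itv omega t -> b t = 0.
Proof.
  intros hw hb dS e.
  assert (hconst : forall t, itv omega t -> S t = S 0).
  { intros t [h0 h1].
    assert (k1 : - S 0 <= - S t).
    { apply (derive_monotone (fun s => - S s) (fun s => - b s)); [exact h0 | |].
      - intros s hs. apply (@is_derive_opp R_AbsRing R_NormedModule). apply dS. unfold itv; lra.
      - intros s hs. specialize (hb s). unfold itv in hb. lra. }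
    assert (k2 : - S t <= - S omega).
    { apply (derive_monotone (fun s => - S s) (fun s => - b s)); [exact h1 | |].
      - intros s hs. apply (@is_derive_opp R_AbsRing R_NormedModule). apply dS. unfold itv; lra.
      - intros s hs. specialize (hb s). unfold itv in hb. lra. }
    lra. }
  intros t ht. destruct (Req_dec (b t) 0) as [h | h]; [exact h | exfalso].
  pose proof (Rabs_pos_lt _ h) as hp.
  destruct (is_derive_eps S t (b t) (dS t ht) (Rabs (b t) / 2)) as [d [hd H]]; [lra |].
  (* [S] is known to be constant only on the interval, so the difference quotient uses a point on
     the side of [t] that remains inside it. *)
  assert (hs : exists s, itv omega s /\ s <> t /\ Rabs (s - t) < d).
  { destruct ht as [h0 h1]. set (x := Rmin (d / 2) (omega / 2)).
    assert (0 < x) by (unfold x; apply Rmin_pos; lra).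
    assert (x <= d / 2) by apply Rmin_l. assert (x <= omega / 2) by apply Rmin_r.
    destruct (Rle_dec t (omega / 2)).
    - exists (t + x). unfold itv. rewrite Rabs_pos_eq; lra.
    - exists (t - x). unfold itv. rewrite Rabs_left; lra. }
  destruct hs as [s [h1 [h2 h3]]]. specialize (H s h3).
  rewrite (hconst s h1) (hconst t ht) in H.
  replace (S 0 - S 0 - (s - t) * b t) with (- ((s - t) * b t)) in H by ring.
  rewrite Rabs_Ropp Rabs_mult in H.
  assert (0 < Rabs (s - t)) by (apply Rabs_pos_lt; lra). nra.
Qed.

(** * The counts in the three cases *)

Section Counting.
Variables (k : nat) (omega : R) (alpha beta : R -> R).
Hypothesis homega : 0 < omega.
Hypothesis halpha : cont_itv omega alpha.
Hypothesis hbeta : cont_itv omega beta.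
Hypothesis beta_le : forall t, itv omega t -> beta t <= 0.
Notation sol_ab := (sol (k + 3) omega alpha beta).

Let itv0 : itv omega 0.
Proof. unfold itv; lra. Qed.

Let itvw : itv omega omega.
Proof. unfold itv; lra. Qed.

(** The integrals A and B are converted once into increments of primitives, so that existence can be
    read off their signs. *)
Lemma exists_primitives : exists P S : R -> R,
  (forall t, itv omega t -> is_derive P t (alpha t)) /\
  (forall t, itv omega t -> is_derive S t (beta t)) /\
  P omega - P 0 = RInt alpha 0 omega /\ S omega - S 0 = RInt beta 0 omega /\
  ((S omega - S 0 < 0 \/ (S omega - S 0 = 0 /\ P omega - P 0 < 0)) ->
    exists z, sol_ab z /\ z omega = z 0 /\ positive_sol omega z) /\
  ((S omega - S 0 < 0 \/ (S omega - S 0 = 0 /\ 0 < P omega - P 0)) ->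
    exists z, sol_ab z /\ z omega = z 0 /\ negative_sol omega z).
Proof.
  destruct (coefficients_extend omega alpha beta homega halpha hbeta)
    as [a [b [A [ca [cb [ba [bb [ea eb]]]]]]]].
  exists (fun t => RInt a 0 t), (fun t => RInt b 0 t).
  assert (dP : forall t, is_derive (fun t => RInt a 0 t) t (a t)).
  { intros t. now apply (is_derive_primitive R_CompleteNormedModule a t). }
  assert (dS : forall t, is_derive (fun t => RInt b 0 t) t (b t)).
  { intros t. now apply (is_derive_primitive R_CompleteNormedModule b t). }
  assert (b_le : forall t, itv omega t -> b t <= 0).
  { intros t ht. rewrite (eb t ht). now apply beta_le. }
  split; [intros t ht; rewrite <- (ea t ht); apply dP |].
  split; [intros t ht; rewrite <- (eb t ht); apply dS |].
  split.
  { rewrite RInt_point. change (RInt a 0 omega - 0 = RInt alpha 0 omega). rewrite Rminus_0_r.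
    apply RInt_ext. intros t ht. rewrite Rmin_left ?Rmax_right in ht; try lra.
    apply ea. unfold itv; lra. }
  split.
  { rewrite RInt_point. change (RInt b 0 omega - 0 = RInt beta 0 omega). rewrite Rminus_0_r.
    apply RInt_ext. intros t ht. rewrite Rmin_left ?Rmax_right in ht; try lra.
    apply eb. unfold itv; lra. }
  split; intros h.
  - destruct (exists_positive_periodic k omega A a b homega ca cb ba bb
      (fun t => RInt a 0 t) (fun t => RInt b 0 t) b_le (fun t _ => dP t) (fun t _ => dS t) h)
      as [z [hz [h1 h2]]].
    exists z. split; [| split; [exact h1 | exact h2]].
    now apply (sol_coefficients (k + 3) omega alpha beta a b z ea eb).
  - destruct (exists_negative_periodic k omega A a b
      (fun t => RInt a 0 t) (fun t => RInt b 0 t) homega ca cb ba bb b_le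
      (fun t _ => dP t) (fun t _ => dS t) h)
      as [z [hz [h1 h2]]].
    exists z. split; [| split; [exact h1 | exact h2]].
    now apply (sol_coefficients (k + 3) omega alpha beta a b z ea eb).
Qed.

Lemma periodic_extend (z : R -> C) : periodic_solution (k + 3) omega alpha beta z ->
  exists Z, (forall t, itv omega t -> Z t = z t) /\ sol_ab Z /\ Z omega = Z 0.
Proof.
  intros [hz hper].
  destruct (is_solution_extend _ _ _ _ _ homega hz) as [Z [e hZ]].
  exists Z. split; [exact e |]. split; [exact hZ |]. now rewrite !e.
Qed.

Lemma nonzero_sign (z : R -> C) : periodic_solution (k + 3) omega alpha beta z ->
  nonzero_sol omega z -> positive_sol omega z \/ negative_sol omega z.
Proof.
  intros hz hn. destruct (periodic_extend z hz) as [Z [e [hZ hper]]].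
  assert (hZ0 : Z 0 <> RtoC 0).
  { intros e0. apply hn. intros t ht. rewrite <- (e t ht).
    exact (sol_unique_cont _ omega alpha beta homega halpha hbeta Z (fun _ => RtoC 0) 0
             hZ (sol_zero k omega alpha beta) itv0 e0 t ht). }
  destruct (periodic_sign k omega alpha beta homega halpha hbeta beta_le Z hZ hper hZ0) as [h | h];
    [left | right]; intros t ht; rewrite <- (e t ht); now apply h.
Qed.

Lemma sign_nonzero (z : R -> C) : positive_sol omega z \/ negative_sol omega z ->
  nonzero_sol omega z /\ real_sol omega z.
Proof.
  intros [h | h]; (split; [| intros t ht; now apply h]); intros h0;
    specialize (h0 0 itv0); destruct (h 0 itv0) as [_ h1]; rewrite h0 in h1;
    unfold Re in h1; simpl in h1; lra.
Qed.

Lemma same_sign_unique (z w : R -> C) :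
  periodic_solution (k + 3) omega alpha beta z -> periodic_solution (k + 3) omega alpha beta w ->
  (positive_sol omega z /\ positive_sol omega w) \/ (negative_sol omega z /\ negative_sol omega w) ->
  z 0 = w 0.
Proof.
  intros hz hw hs.
  destruct (periodic_extend z hz) as [Z [ez [hZ pz]]].
  destruct (periodic_extend w hw) as [W [ew [hW pw]]].
  rewrite <- (ez 0 itv0), <- (ew 0 itv0).
  apply (periodic_unique k omega alpha beta homega halpha hbeta beta_le Z W hZ hW pz pw).
  intros t ht. rewrite (ez t ht) (ew t ht).
  destruct hs as [[h1 h2] | [h1 h2]]; destruct (h1 t ht), (h2 t ht); nra.
Qed.

(** Each listed solution has multiplicity 1 by [simple_zero] and [variational_ne_1], so the count is
    the length of the list. Matching uses the value at 0 only, since equal solutions may differ as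
    functions off the interval. *)
Lemma count_of_list (l : list (R -> C)) (Q : (R -> C) -> Prop) :
  (forall z, In z l -> sol_ab z /\ z omega = z 0 /\ z 0 <> RtoC 0 /\ Q z) ->
  NoDup (map (fun z => z 0) l) ->
  (forall z, periodic_solution (k + 3) omega alpha beta z -> Q z ->
     exists u, In u l /\ u 0 = z 0) ->
  count_periodic (k + 3) omega alpha beta Q (length l).
Proof.
  intros hl hnd hall.
  exists (map (fun z => (z 0, 1%nat)) l).
  assert (e1 : map fst (map (fun z : R -> C => (z 0, 1%nat)) l) = map (fun z => z 0) l).
  { rewrite map_map. reflexivity. }
  rewrite e1. split; [exact hnd |]. split; [| split].
  - intros c. rewrite in_map_iff. split.
    + intros [z [e hz]]. destruct (hl z hz) as [h1 [h2 [_ h3]]].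
      exists z. split; [| split; [exact h3 | exact e]].
      split; [now apply sol_is_solution | now rewrite h2].
    + intros [z [hz [hQ e]]]. destruct (hall z hz hQ) as [u [hu eu]].
      exists u. split; [now rewrite eu | exact hu].
  - intros c m hcm. apply in_map_iff in hcm. destruct hcm as [z [e hz]].
    injection e as e2 e3. subst c m. destruct (hl z hz) as [h1 [h2 [h3 _]]]. split.
    + exists z. split; [now apply sol_is_solution | reflexivity].
    + apply simple_zero; auto. intros D D0 hD.
      exact (variational_ne_1 k omega alpha beta homega halpha hbeta beta_le z D h1 h2 h3 D0 hD).
  - clear. induction l as [|z l IH]; simpl; [reflexivity | now rewrite IH].
Qed.

Lemma sign_start (z : R -> C) : positive_sol omega z \/ negative_sol omega z -> z 0 <> RtoC 0.
Proof.
  intros [h | h] e; destruct (h 0 itv0) as [_ h1]; rewrite e in h1; unfold Re in h1; simpl in h1; lra.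
Qed.

Lemma sol_periodic (z : R -> C) : sol_ab z -> z omega = z 0 ->
  periodic_solution (k + 3) omega alpha beta z.
Proof. intros h1 h2. split; [now apply sol_is_solution | now rewrite h2]. Qed.

(** [Q] covers both the non-zero solutions and the non-zero real ones: the two signed solutions
    satisfy either predicate and exhaust it. *)
Lemma count_B_neg (Q : (R -> C) -> Prop) : RInt beta 0 omega < 0 ->
  (forall z, Q z -> nonzero_sol omega z) ->
  (forall z, positive_sol omega z \/ negative_sol omega z -> Q z) ->
  count_periodic (k + 3) omega alpha beta Q 2 /\
  count_periodic (k + 3) omega alpha beta (positive_sol omega) 1 /\
  count_periodic (k + 3) omega alpha beta (negative_sol omega) 1.
Proof.
  intros hB hQ1 hQ2.
  destruct exists_primitives as [P [S [_ [_ [_ [eS [hp hn]]]]]]].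
  destruct hp as [zp [p1 [p2 p3]]]; [left; lra |].
  destruct hn as [zn [n1 [n2 n3]]]; [left; lra |].
  pose proof (sol_periodic zp p1 p2) as pp. pose proof (sol_periodic zn n1 n2) as pn.
  split; [| split].
  - apply (count_of_list (zp :: zn :: nil)).
    + intros z [<- | [<- | []]]; (split; [assumption | split; [assumption | split]]); auto;
        apply sign_start; auto.
    + constructor; [| constructor; [simpl; tauto | constructor]].
      intros [e | []]. destruct (p3 0 itv0) as [_ h1]. destruct (n3 0 itv0) as [_ h2].
      rewrite e in h2. lra.
    + intros z hz hq. destruct (nonzero_sign z hz (hQ1 z hq)) as [h | h].
      * exists zp. split; [simpl; auto |]. apply same_sign_unique; auto.
      * exists zn. split; [simpl; auto |]. apply same_sign_unique; auto.
  - apply (count_of_list (zp :: nil)).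
    + intros z [<- | []]; (split; [assumption | split; [assumption | split]]); auto.
      apply sign_start; auto.
    + constructor; [simpl; tauto | constructor].
    + intros z hz hq. exists zp. split; [simpl; auto |]. apply same_sign_unique; auto.
  - apply (count_of_list (zn :: nil)).
    + intros z [<- | []]; (split; [assumption | split; [assumption | split]]); auto.
      apply sign_start; auto.
    + constructor; [simpl; tauto | constructor].
    + intros z hz hq. exists zn. split; [simpl; auto |]. apply same_sign_unique; auto.
Qed.

(** B = 0 together with beta <= 0 forces beta to vanish on the interval, which brings
    [periodic_sign_alpha] into play. *)
Lemma sign_of_A (z : R -> C) : RInt beta 0 omega = 0 ->
  periodic_solution (k + 3) omega alpha beta z ->
  (positive_sol omega z -> RInt alpha 0 omega < 0) /\
  (negative_sol omega z -> 0 < RInt alpha 0 omega).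
Proof.
  intros hB hz. destruct exists_primitives as [P [S [dP [dS [eP [eS _]]]]]].
  assert (b0 : forall t, itv omega t -> beta t = 0).
  { apply (zero_of_integral_zero omega beta S homega beta_le dS). lra. }
  destruct (periodic_extend z hz) as [Z [e [hZ hper]]].
  destruct (periodic_sign_alpha k omega alpha beta homega Z P b0 dP hZ hper) as [h1 h2].
  split; intros h.
  - assert (P omega < P 0); [| lra]. apply h1. intros t ht. rewrite (e t ht). now apply h.
  - assert (P 0 < P omega); [| lra]. apply h2. intros t ht. rewrite (e t ht). now apply h.
Qed.

Lemma count_B_zero : RInt beta 0 omega = 0 -> RInt alpha 0 omega <> 0 ->
  count_periodic (k + 3) omega alpha beta (nonzero_sol omega) 1.
Proof.
  intros hB hA. destruct exists_primitives as [P [S [_ [_ [eP [eS [hp hn]]]]]]].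
  destruct (Rtotal_order (RInt alpha 0 omega) 0) as [h | [h | h]]; [| contradiction |].
  - destruct hp as [z [h1 [h2 h3]]]; [right; lra |].
    apply (count_of_list (z :: nil)).
    + intros u [<- | []]. split; [exact h1 | split; [exact h2 | split]];
        [apply sign_start; auto | apply sign_nonzero; auto].
    + constructor; [simpl; tauto | constructor].
    + intros u hu hq. exists z. split; [simpl; auto |].
      apply same_sign_unique; auto using sol_periodic.
      destruct (nonzero_sign u hu hq) as [s | s]; [auto |].
      pose proof (proj2 (sign_of_A u hB hu) s). lra.
  - destruct hn as [z [h1 [h2 h3]]]; [right; lra |].
    apply (count_of_list (z :: nil)).
    + intros u [<- | []]. split; [exact h1 | split; [exact h2 | split]];
        [apply sign_start; auto | apply sign_nonzero; auto].
    + constructor; [simpl; tauto | constructor].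
    + intros u hu hq. exists z. split; [simpl; auto |].
      apply same_sign_unique; auto using sol_periodic.
      destruct (nonzero_sign u hu hq) as [s | s]; [| auto].
      pose proof (proj1 (sign_of_A u hB hu) s). lra.
Qed.

Lemma count_zero : RInt beta 0 omega = 0 -> RInt alpha 0 omega = 0 ->
  count_periodic (k + 3) omega alpha beta (nonzero_sol omega) 0.
Proof.
  intros hB hA. apply (count_of_list nil).
  - intros z [].
  - constructor.
  - intros z hz hq. destruct (sign_of_A z hB hz) as [h1 h2].
    destruct (nonzero_sign z hz hq) as [s | s]; [specialize (h1 s) | specialize (h2 s)]; lra.
Qed.
End Counting.

Theorem corollary3p4 (n : nat) (omega : R) (alpha : R -> R)
    (hn : (3 <= n)%nat) (homega : 0 < omega) (halpha : cont_itv omega alpha) :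
  (forall beta : R -> R,
     cont_itv omega beta ->
     (forall t, itv omega t -> beta t <= 0) ->
     let A := RInt alpha 0 omega in
     let B := RInt beta 0 omega in
     (B < 0 ->
        count_periodic n omega alpha beta (nonzero_sol omega) 2 /\
        (exists k, (k <= 1)%nat /\
           count_periodic n omega alpha beta (positive_sol omega) k) /\
        (exists k, (k <= 1)%nat /\
           count_periodic n omega alpha beta (negative_sol omega) k)) /\
     (B = 0 -> A <> 0 ->
        count_periodic n omega alpha beta (nonzero_sol omega) 1 /\
        (forall z, periodic_solution n omega alpha beta z -> nonzero_sol omega z ->
           real_sol omega z /\
           (A < 0 -> positive_sol omega z) /\
           (A > 0 -> negative_sol omega z))) /\
     (A = 0 -> B = 0 ->
        count_periodic n omega alpha beta (nonzero_sol omega) 0)) /\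
  (exists eps : R, 0 < eps /\
     forall beta : R -> R,
       cont_itv omega beta ->
       (forall t, itv omega t -> beta t <= 0) ->
       - eps < RInt beta 0 omega < 0 ->
       count_periodic n omega alpha beta
         (fun z => nonzero_sol omega z /\ real_sol omega z) 2).
Proof.
  replace n with ((n - 3) + 3)%nat by lia. set (k := (n - 3)%nat). split.
  - intros beta hbeta hle A B. split; [| split].
    + intros hB.
      destruct (count_B_neg k omega alpha beta homega halpha hbeta hle (nonzero_sol omega) hB)
        as [h1 [h2 h3]]; [auto | intros z hz; now apply sign_nonzero |].
      split; [exact h1 |]. split; exists 1%nat; split; auto.
    + intros hB hA. split; [now apply count_B_zero |].
      intros z hz hnz.
      pose proof (nonzero_sign k omega alpha beta homega halpha hbeta hle z hz hnz) as hs.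
      destruct (sign_of_A k omega alpha beta homega halpha hbeta hle z hB hz) as [h1 h2].
      split; [now apply (sign_nonzero omega homega z) |].
      fold A in h1, h2.
      split; intros h; destruct hs as [s | s]; auto;
        [specialize (h2 s) | specialize (h1 s)]; lra.
    + intros hA hB. now apply count_zero.
  (* Any positive number would serve, since the count holds for every B < 0. *)
  - exists 1. split; [lra |]. intros beta hbeta hle hB.
    apply (count_B_neg k omega alpha beta homega halpha hbeta hle); [lra | tauto |].
    intros z hz. now apply sign_nonzero.
Qed.
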